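(* Let $W=\mathbb{R}^3(x,y,z)$ with contact form $\alpha=dz-y\,dx$, and let $\hat G=\mathrm{CSp}(2,\mathbb{R})=\mathrm{GL}(2,\mathbb{R})$ act on $W$ by $$\Phi_A(x,y,z)=\bigl(ax+by,\ cx+dy,\ (ad-bc)(z-\tfrac12xy)+\tfrac12(ax+by)(cx+dy)\bigr),\quad A=\begin{pmatrix}a&b\\c&d\end{pmatrix}.$$ For curves $y=y(x)$, $z=z(x)$ in $W$ put $$I_1=\frac{z_1-y}{xy_1-y},\qquad I'_{2a}=\frac{(2z-xy)^2}{(xy_1-y)^3}\,y_2,\qquad \nabla'=\frac{2z-xy}{xy_1-y}\,\mathcal{D}_x .$$ Then the algebra of differential invariants of the $\hat G$-action on the space $J^\infty(W,1)$ of infinite jets of curves in $W$ is freely generated as $$\mathcal{A}_{\hat G}=\langle I_1,I'_{2a}\,;\,\nabla'\rangle.$$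
   Context: $J^k(W,1)$ is the space of $k$-jets of unparametrized curves in $W$, with coordinates $x,y,z,y_l,z_l$ ($1\le l\le k$), where $y_l,z_l$ are the $l$-th derivatives with respect to $x$; $\mathcal{D}_x$ is the total derivative. $\hat G$ acts on $J^k(W,1)$ by prolongation. A differential invariant of order $k$ is a function on $J^k(W,1)$ constant on orbits of the prolonged action; differential invariants are taken to be rational functions of the jet-variables (and may be chosen polynomial in jet-variables of sufficiently high order). $\mathcal{A}_{\hat G}$ is the algebra of all differential invariants. An invariant derivation is a derivation $f\mathcal{D}_x$, $f$ a function on a finite jet space, commuting with the prolonged action. 'Freely generated as $\langle I_1,I'_{2a};\nabla'\rangle$' means: every element of the algebra is a rational expression in finitely many functions $(\nabla')^jI_1$, $(\nabla')^jI'_{2a}$, $j\ge0$, and these functions are algebraically independent (no differential syzygies). *)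

(* Defs.v *)
From HB Require Import structures.
From mathcomp Require Import all_boot all_order all_algebra.
From mathcomp Require Import reals.
From mathcomp Require Import mpoly.

Set Implicit Arguments.
Unset Strict Implicit.
Unset Printing Implicit Defensive.

Import GRing.Theory.
Local Open Scope ring_scope.

Local Notation "x %:F" := (@FracField.tofrac _ x) : ring_scope.

(* Polymorphic in the algebra T, so that it applies both to the points of
   W = R^3 (T := R^o) and to polynomial curves in W (T := {poly R}). *)
Definition Phi (R : realType) (T : comAlgType R) (A : 'M[R]_2)
    (w : T * T * T) : T * T * T :=
  let: (x, y, z) := w in
  let a := A 0 0 in let b := A 0 1 in let c := A 1 0 in let d := A 1 1 in
  let X := a *: x + b *: y in
  let Y := c *: x + d *: y in
  (X, Y, (a * d - b * c) *: (z - 2^-1 *: (x * y)) + 2^-1 *: (X * Y)).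

(* The coordinates of J^k(W,1) are x, y_0, z_0, ..., y_k, z_k, with y_0 = y
   and z_0 = z, numbered in this order; the number of a coordinate does not
   depend on k. *)
Definition ncoord (k : nat) : nat := k.*2.+3.
Definition ix (k : nat) : 'I_(ncoord k) := inord 0.
Definition iy (k l : nat) : 'I_(ncoord k) := inord l.*2.+1.
Definition iz (k l : nat) : 'I_(ncoord k) := inord l.*2.+2.

Definition jet (R : realType) (k : nat) : Type := 'I_(ncoord k) -> R.

Definition is_jet_of (R : realType) (k : nat) (p : jet R k) (u v : {poly R}) :
    Prop :=
  forall l : nat, (l <= k)%N ->
    u^`(l).[p (ix k)] = p (iy k l) /\ v^`(l).[p (ix k)] = p (iz k l).

(* q is the image of p under the prolongation of Phi A to J^k: for a curve
   y = u(x), z = v(x) with k-jet p, the image t |-> (X(t), Y(t), Z(t)) of its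
   parametrization t |-> (t, u(t), v(t)) is transversal to the fibres of x and
   has contact of order k with a curve y = U(x), z = V(x) with k-jet q.
   As every k-jet is the jet of a polynomial curve and the k-jet of the image
   depends only on p, polynomial curves are sufficient. *)
Definition prolong (R : realType) (k : nat) (A : 'M[R]_2) (p q : jet R k) :
    Prop :=
  exists u v U V : {poly R},
    let: (X, Y, Z) := Phi A ('X, u, v) in
    let t0 := p (ix k) in
    [/\ is_jet_of p u v, is_jet_of q U V,
        X.[t0] = q (ix k) /\ X^`().[t0] != 0,
        ('X - t0%:P) ^+ k.+1 %| Y - (U \Po X) &
        ('X - t0%:P) ^+ k.+1 %| Z - (V \Po X)].

Notation jetpoly R k := {mpoly R[ncoord k]}.
Notation jetrat R k := {fraction {mpoly R[ncoord k]}}.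

Definition jx (R : realType) (k : nat) : jetrat R k := ('X_(ix k))%:F.
Definition jy (R : realType) (k l : nat) : jetrat R k := ('X_(iy k l))%:F.
Definition jz (R : realType) (k l : nat) : jetrat R k := ('X_(iz k l))%:F.

(* f is defined at p, with value c there. *)
Definition has_value (R : realType) (k : nat) (f : jetrat R k) (p : jet R k)
    (c : R) : Prop :=
  exists P Q : jetpoly R k,
    [/\ Q.@[p] != 0, f = P%:F / Q%:F & c = P.@[p] / Q.@[p]].

(* g is the pullback of f by the prolongation of Phi A to J^k. *)
Definition is_pullback (R : realType) (k : nat) (A : 'M[R]_2)
    (f g : jetrat R k) : Prop :=
  forall (p q : jet R k), prolong A p q ->
  forall c c' : R, has_value f q c -> has_value g p c' -> c = c'.

Definition diff_invariant (R : realType) (k : nat) (f : jetrat R k) : Prop :=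
  forall A : 'M[R]_2, A \in unitmx -> is_pullback A f f.

(* Pullback of functions along the projection J^K -> J^k; only meaningful for
   k <= K. *)
Definition poly_lift (R : realType) (k K : nat) (p : jetpoly R k) :
    jetpoly R K :=
  mmap (@mpolyC (ncoord K) R)
       (fun i : 'I_(ncoord k) => 'X_(inord i : 'I_(ncoord K))) p.

Definition rat_lift (R : realType) (k K : nat) (f : jetrat R k) : jetrat R K :=
  (poly_lift K (\n_(repr f)))%:F / (poly_lift K (\d_(repr f)))%:F.

(* The total derivative: D_x x = 1, D_x y_l = y_(l+1), D_x z_l = z_(l+1); in
   the numbering of the coordinates the last two shift the index by 2. *)
Definition Dpoly (R : realType) (k : nat) (p : jetpoly R k) : jetpoly R k.+1 :=
  \sum_(i < ncoord k)
    (if i == ix k then 1 else 'X_(inord i.+2 : 'I_(ncoord k.+1)))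
    * poly_lift k.+1 p^`M(i).

Definition Dx (R : realType) (k : nat) (f : jetrat R k) : jetrat R k.+1 :=
  let n := \n_(repr f) in let d := \d_(repr f) in
  (Dpoly n * poly_lift k.+1 d - poly_lift k.+1 n * Dpoly d)%:F
  / (poly_lift k.+1 d ^+ 2)%:F.

(* The derivation s D_x, on functions on J^k for r <= k.+1. *)
Definition derivation (R : realType) (r : nat) (s : jetrat R r) (k : nat)
    (f : jetrat R k) : jetrat R k.+1 :=
  rat_lift k.+1 s * Dx f.

Definition invariant_derivation (R : realType) (r : nat) (s : jetrat R r) :
    Prop :=
  forall A : 'M[R]_2, A \in unitmx ->
  forall (k : nat) (f g : jetrat R k), (r <= k.+1)%N ->
    is_pullback A f g -> is_pullback A (derivation s f) (derivation s g).

Fixpoint derivation_iter (R : realType) (r : nat) (s : jetrat R r) (k : nat)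
    (f : jetrat R k) (j : nat) : jetrat R (j + k) :=
  if j is j'.+1 then derivation s (derivation_iter s f j') else f.

Definition I1 (R : realType) : jetrat R 1 :=
  (jz R 1 1 - jy R 1 0) / (jx R 1 * jy R 1 1 - jy R 1 0).

Definition I2a' (R : realType) : jetrat R 2 :=
  (2 * jz R 2 0 - jx R 2 * jy R 2 0) ^+ 2
  / (jx R 2 * jy R 2 1 - jy R 2 0) ^+ 3 * jy R 2 2.

Definition nabla'_coef (R : realType) : jetrat R 1 :=
  (2 * jz R 1 0 - jx R 1 * jy R 1 0) / (jx R 1 * jy R 1 1 - jy R 1 0).

(* The 2m functions nabla'^j I1 and nabla'^j I2a', j < m, on J^(m+1). *)
Definition generators (R : realType) (m : nat) (i : 'I_(m + m)) :
    jetrat R m.+1 :=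
  match split i with
  | inl j => rat_lift m.+1 (derivation_iter (nabla'_coef R) (I1 R) j)
  | inr j => rat_lift m.+1 (derivation_iter (nabla'_coef R) (I2a' R) j)
  end.

Definition subst_generators (R : realType) (m : nat) (P : {mpoly R[m + m]}) :
    jetrat R m.+1 :=
  mmap (fun c : R => (c%:MP_[ncoord m.+1])%:F) (@generators R m) P.

Definition rational_in_generators (R : realType) (k : nat) (f : jetrat R k) :
    Prop :=
  exists2 m : nat, (k <= m.+1)%N &
  exists2 Q : {mpoly R[m + m]}, subst_generators Q != 0 &
  exists P : {mpoly R[m + m]},
    rat_lift m.+1 f = subst_generators P / subst_generators Q.

(* Main.v *)
(* By jet calculus every function of jets can be evaluated along polynomial
   curves (u, v), where the total derivative becomes d/dt.  The image of the
   curve under [Phi A] has the jet obtained by applying powers of (1/X') d/dt to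
   its components, so the pullback of a polynomial on jets is a polynomial
   divided by a power of X'; this turns pointwise invariance into polynomial
   identities, which can be differentiated.

   Put h = 2z - xy and d = x y_1 - y.  They are multiplied by det A and
   det A / X', whence the invariance of I_1, I'_2a and nabla'.  On the jets with
   prescribed x, y, z, y_1 (and h, d <> 0), a cross-section of the orbits met
   exactly once by each generic orbit, nabla'^j I_1 is affine in z_(j+1) and
   nabla'^j I'_2a is affine in y_(j+2), with nonzero constant leading
   coefficient and remainder depending on earlier coordinates only.  Solving
   this triangular system expresses all coordinates on the section by the
   generators, so an invariant function, being determined by its restriction to
   the section, is rational in them; and since the system can be solved for
   arbitrary values of the generators, these are algebraically independent.  The
   section has to pass through a point where the denominator of the given
   invariant does not vanish. *)
Require Import Defs.
From mathcomp Require Import all_boot all_order all_algebra.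
From mathcomp Require Import generic_quotient.
From mathcomp Require Import reals mpoly ring zify.
From mathcomp Require boolp.

Set Implicit Arguments.
Unset Strict Implicit.
Unset Printing Implicit Defensive.

Import GRing.Theory Num.Theory.
Local Open Scope ring_scope.

Local Notation "x %:F" := (@FracField.tofrac _ x) : ring_scope.

(** * Polynomials and polynomial functions *)

(** Induction over sums and products suits properties with a Leibniz rule, which need no treatment
    of monomials. *)
Lemma mpoly_ring_ind (R : comNzRingType) (n : nat) (K : {mpoly R[n]} -> Prop) :
  (forall c, K c%:MP) -> (forall i, K 'X_i) ->
  (forall p q, K p -> K q -> K (p + q)) ->
  (forall p q, K p -> K q -> K (p * q)) -> forall p, K p.
Proof.
move=> KC KX KD KM; elim/mpolyind => [|c m p _ _ Kp]; first by rewrite -mpolyC0.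
apply: KD => //; rewrite -mul_mpolyC; apply: (KM) => //; rewrite mpolyXE_id.
apply: (big_ind K) => [||i _] //; first by rewrite -mpolyC1.
by elim: (m i) => [|e IHe]; rewrite ?expr0 -?mpolyC1 // exprS; apply: (KM).
Qed.

(** The multivariate chain rule; with jet coordinates for [h] it becomes the formula for the total
    derivative. *)
Lemma deriv_mmap (R : comNzRingType) (n : nat) (h : 'I_n -> {poly R})
    (p : {mpoly R[n]}) :
  (mmap polyC h p)^`() = \sum_i (h i)^`() * mmap polyC h p^`M(i).
Proof.
elim/mpoly_ring_ind: p => [c|i|p q IHp IHq|p q IHp IHq].
- rewrite mmapC derivC big1 // => i _.
  by rewrite mderivC raddf0 mulr0.
- rewrite mmapX mmap1U (bigD1 i) //= big1 ?addr0 => [|j ji].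
    by rewrite mderivX mnm1E eqxx scale1r -{1}[U_(i)%MM]add0m addmK mmapX mmap11 mulr1.
  by rewrite mderivX mnm1E eq_sym (negbTE ji) scale0r raddf0 mulr0.
- rewrite mmapD derivD IHp IHq -big_split; apply: eq_bigr => i _.
  by rewrite mderivD mmapD mulrDr.
- rewrite rmorphM derivM IHp IHq mulr_suml mulr_sumr -big_split.
  apply: eq_bigr => i _; rewrite mderivM mmapD !rmorphM /=; ring.
Qed.

Lemma horner_mmap (R : comNzRingType) (n : nat) (h : 'I_n -> {poly R})
    (p : {mpoly R[n]}) (t : R) :
  (mmap polyC h p).[t] = p.@[fun i => (h i).[t]].
Proof.
elim/mpoly_ring_ind: p => [c|i|p q IHp IHq|p q IHp IHq].
- by rewrite mmapC hornerC mevalC.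
- by rewrite mmapX mmap1U mevalXU.
- by rewrite mmapD hornerD IHp IHq mevalD.
- by rewrite rmorphM hornerM IHp IHq mevalM.
Qed.

Lemma meval_mmap (R : comNzRingType) (n m : nat) (h : 'I_n -> {mpoly R[m]})
    (p : {mpoly R[n]}) (w : 'I_m -> R) :
  (mmap (@mpolyC m R) h p).@[w] = p.@[fun i => (h i).@[w]].
Proof.
elim/mpoly_ring_ind: p => [c|i|p q IHp IHq|p q IHp IHq].
- by rewrite mmapC !mevalC.
- by rewrite mmapX mmap1U mevalXU.
- by rewrite mmapD !mevalD IHp IHq.
- by rewrite rmorphM !mevalM IHp IHq.
Qed.

Lemma poly_fun_eq0 (R : numDomainType) (p : {poly R}) :
  (forall t, p.[t] = 0) -> p = 0.
Proof.
move=> p0; apply: (@roots_geq_poly_eq0 _ p [seq i%:R | i <- iota 0 (size p)]).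
- by apply/allP => x _; apply/rootP/p0.
- by rewrite map_inj_uniq ?iota_uniq // => i j /eqP; rewrite eqr_nat => /eqP.
- by rewrite size_map size_iota.
Qed.

(* Since the partial derivatives of a polynomial vanishing everywhere vanish
   everywhere as well, induction on the degree applies. *)
Lemma mpoly_fun_eq0 (R : numDomainType) (n : nat) (p : {mpoly R[n]}) :
  (forall w, p.@[w] = 0) -> p = 0.
Proof.
have [k] := ubnP (msize p); elim: k => // k IHk in p * => le_pk p0.
have dp0 i : p^`M(i) = 0.
  have [->|nzp] := eqVneq p 0; first by rewrite mderiv0.
  apply: IHk => [|w].
    rewrite ltnS in le_pk; apply: leq_trans le_pk.
    rewrite -(prednK (n := msize p)) ?lt0n ?msize_poly_eq0 // ltnS msizeE.
    rewrite big_seq.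
    apply/bigmax_leqP_seq => m; rewrite mcoeff_msupp mcoeff_mderiv => Hm _.
    have : (m + U_(i))%MM \in msupp p.
      by rewrite mcoeff_msupp; apply: contraNneq Hm => ->; rewrite mul0rn.
    move/msize_mdeg_lt; rewrite mdegD mdeg1 addn1.
    by case: (msize p).
  (* [p] is restricted to the line through [w] in direction [i]; the derivative at 0 is the partial
     derivative at [w]. *)
  have := deriv_mmap (fun j => (w j)%:P + (j == i)%:R *: 'X) p.
  rewrite [X in X^`()]poly_fun_eq0 => [|t]; last by rewrite horner_mmap p0.
  move/(congr1 (horner^~ 0)); rewrite deriv0 horner0 horner_sum (bigD1 i) //=.
  rewrite big1 => [|j ji].
    rewrite eqxx scale1r derivD derivC derivX add0r mul1r addr0 horner_mmap.
    move=> e; rewrite [RHS]e; apply: meval_eq => j.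
    by rewrite hornerD hornerC hornerZ hornerX mulr0 addr0.
  by rewrite (negbTE ji) scale0r addr0 derivC mul0r horner0.
(* In characteristic zero the vanishing of all partial derivatives kills every nonconstant
   coefficient. *)
have p_cst : p = (p@_0)%:MP.
  apply/mpolyP => m; rewrite mcoeffC.
  have [->|nzm] := eqVneq m 0%MM; first by rewrite mulr1.
  have [i mi] : exists i, m i != 0%N.
    apply/existsP; apply: contraNT nzm; rewrite negb_exists => /forallP m0.
    by apply/eqP/mnmP => i; rewrite mnm0E; apply/eqP/negPn/m0.
  have := congr1 (mcoeff (m - U_(i))%MM) (dp0 i).
  rewrite mcoeff_mderiv mcoeff0 submK; last first.
    by apply/mnm_lepP => j; rewrite mnm1E; case: eqP => // <-; rewrite lt0n.
  by move/eqP; rewrite mulr0 mulrn_eq0 => /eqP.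
by have := p0 (fun=> 0); rewrite p_cst mevalC => ->; rewrite mpolyC0.
Qed.

(** * Contact of polynomial curves *)

Lemma derivn_comp_shift (R : comNzRingType) (p : {poly R}) (c : R) (l : nat) :
  (p \Po ('X - c%:P))^`(l) = p^`(l) \Po ('X - c%:P).
Proof.
elim: l => [|l IHl]; first by rewrite !derivn0.
by rewrite !derivnS IHl deriv_comp derivB derivX derivC subr0 mulr1.
Qed.

Lemma poly_with_derivatives (R : numFieldType) (w : nat -> R) (t : R) (n : nat) :
  exists u : {poly R}, forall l, (l < n)%N -> u^`(l).[t] = w l.
Proof.
exists ((\poly_(i < n) (w i / i`!%:R)) \Po ('X - t%:P)) => l ln.
rewrite derivn_comp_shift horner_comp !hornerE subrr horner_coef0.
rewrite coef_derivn addn0 ffactnn coef_poly ln -[LHS]mulr_natr divfK //.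
by rewrite pnatr_eq0 -lt0n fact_gt0.
Qed.

Lemma dvdp_sub_comp (R : fieldType) (U p q : {poly R}) :
  p - q %| (U \Po p) - (U \Po q).
Proof.
elim/poly_ind: U => [|U c IHU]; first by rewrite !comp_polyC subrr dvdp0.
rewrite !comp_poly_MXaddC.
have -> : (U \Po p) * p + c%:P - ((U \Po q) * q + c%:P)
  = ((U \Po p) - (U \Po q)) * p + (U \Po q) * (p - q) by ring.
by apply: dvdp_add; [apply: dvdp_mulr|apply: dvdp_mull].
Qed.

(** Powers of [p - p(t)] can be traded for powers of ['X - t] when [p'(t)] is nonzero, since the
    cofactor is then nonzero at [t]. *)
Lemma simple_factor (R : fieldType) (p : {poly R}) (t : R) :
  exists2 S : {poly R}, p - p.[t]%:P = S * ('X - t%:P) & S.[t] = p^`().[t].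
Proof.
have /factor_theorem[S pE] : root (p - p.[t]%:P) t.
  by rewrite rootE !hornerE subrr.
exists S => //; have := congr1 (fun q => q^`().[t]) pE.
rewrite derivB derivC subr0 derivM derivB derivX derivC subr0 mulr1 !hornerE.
by rewrite subrr mulr0 add0r.
Qed.

(** A polynomial form of the inverse function theorem: [Y] is expressed through [X] up to order [n],
    one degree at a time. *)
Lemma contact_exists (R : fieldType) (X Y : {poly R}) (t : R) (n : nat) :
  X^`().[t] != 0 -> exists U : {poly R}, ('X - t%:P) ^+ n %| Y - (U \Po X).
Proof.
move=> X'0; have [S XE S0] := simple_factor X t.
elim: n => [|n [U /dvdpP[G GE]]]; first by exists 0; rewrite expr0 dvd1p.
(* The new term of [U] contributes [c * S^n * ('X - t)^n]; this [c] cancels the leading coefficient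
   [G(t)] of the error. *)
pose c := G.[t] / S.[t] ^+ n.
exists (U + c *: ('X - X.[t]%:P) ^+ n).
rewrite comp_polyD comp_polyZ rmorphXn /= comp_polyB comp_polyX comp_polyC XE.
rewrite opprD addrA GE exprMn scalerAl -mulrBl exprS dvdp_mul2r; last first.
  by rewrite expf_neq0 // polyXsubC_eq0.
rewrite dvdp_XsubCl rootE !hornerE /c divfK ?subrr //.
by rewrite expf_neq0 // S0.
Qed.

(** A reparametrisation with nonzero derivative preserves the order of a zero: each factor
    ['X - xi(s)] turns into ['X - s] times a factor that is nonzero at [s]. *)
Lemma dvdp_comp_simple (R : fieldType) (xi E : {poly R}) (s : R) (n : nat) :
  xi^`().[s] != 0 -> ('X - s%:P) ^+ n %| E \Po xi ->
  ('X - xi.[s]%:P) ^+ n %| E.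
Proof.
move=> xi'0; have [S xiE S0] := simple_factor xi s.
elim: n E => [|n IHn] E; first by rewrite !expr0 !dvd1p.
move=> dE; have /factor_theorem[F FE] : root E xi.[s].
  have : 'X - s%:P %| E \Po xi by apply: dvdp_trans dE; rewrite exprS dvdp_mulr.
  by rewrite dvdp_XsubCl rootE horner_comp.
rewrite FE exprSr dvdp_mul // IHn //.
move: dE; rewrite FE rmorphM /= comp_polyB comp_polyX comp_polyC xiE exprSr.
rewrite mulrA dvdp_mul2r ?polyXsubC_eq0 // Gauss_dvdpl //.
by rewrite coprimep_expl // coprimep_sym coprimep_XsubC rootE S0.
Qed.

(* [curve_deriv X l E] is X'^(2l) (d/dX)^l E. *)
Fixpoint curve_deriv (R : comNzRingType) (X : {poly R}) (l : nat) (E : {poly R}) :=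
  if l is l'.+1 then
    (curve_deriv X l' E)^`() * X^`() - curve_deriv X l' E * X^`()^`() *+ l'.*2
  else E.

Lemma curve_deriv_comp (R : comNzRingType) (X U : {poly R}) (l : nat) :
  curve_deriv X l (U \Po X) = X^`() ^+ l.*2 * (U^`(l) \Po X).
Proof.
elim: l => [|l IHl]; first by rewrite derivn0 expr0 mul1r.
rewrite /= IHl derivM deriv_exp deriv_comp -derivnS doubleS.
(* The exponent in the derivative of a power is a truncated predecessor, hence the case
   distinction. *)
case: (l.*2) => [|m] /=; first by rewrite !mulr0n; ring.
rewrite !exprS !mulrnAl mulrDl mulrnAl addrAC -mulrnBl.
by rewrite [X in X *+ _](_ : _ = 0) ?mul0rn ?add0r; ring.
Qed.

Lemma curve_derivB (R : comNzRingType) (X E F : {poly R}) (l : nat) :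
  curve_deriv X l (E - F) = curve_deriv X l E - curve_deriv X l F.
Proof.
by elim: l => //= l ->; rewrite derivB !mulrBl mulrnBl; ring.
Qed.

Lemma dvdp_deriv_XsubC (R : fieldType) (p : {poly R}) (t : R) (n : nat) :
  ('X - t%:P) ^+ n.+1 %| p -> ('X - t%:P) ^+ n %| p^`().
Proof.
case/dvdpP => q ->; rewrite derivM dvdp_add //.
  by rewrite exprS !dvdp_mull.
by rewrite deriv_exp mulrnAr mulrA -mulrnAl dvdp_mull.
Qed.

(** Each differentiation lowers the order of vanishing by at most one. *)
Lemma dvdp_curve_deriv (R : fieldType) (X E : {poly R}) (t : R) (l n : nat) :
  ('X - t%:P) ^+ (n + l) %| E -> ('X - t%:P) ^+ n %| curve_deriv X l E.
Proof.
elim: l n => [|l IHl] n; first by rewrite addn0.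
rewrite addnS -addSn => /IHl dE /=; rewrite dvdp_sub //.
  by rewrite dvdp_mulr // dvdp_deriv_XsubC.
by rewrite -mulrnAr dvdp_mulr // (dvdp_trans _ dE) // exprS dvdp_mull.
Qed.

(** Contact of order [k] survives [l <= k] differentiations, so the derivatives of [U] can be read
    off the parametrized curve [(X, Y)]. *)
Lemma curve_deriv_contact (R : fieldType) (X Y U : {poly R}) (t : R) (k l : nat) :
  ('X - t%:P) ^+ k.+1 %| Y - (U \Po X) -> (l <= k)%N ->
  (curve_deriv X l Y).[t] = X^`().[t] ^+ l.*2 * U^`(l).[X.[t]].
Proof.
move=> dE lk.
have : 'X - t%:P %| curve_deriv X l (Y - (U \Po X)).
  rewrite -['X - _]expr1; apply: dvdp_curve_deriv.
  by apply: dvdp_trans dE; rewrite dvdp_exp2l.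
rewrite curve_derivB dvdp_XsubCl rootE hornerD hornerN subr_eq0 => /eqP ->.
by rewrite curve_deriv_comp hornerM horner_exp horner_comp.
Qed.

(** * Images of curves and prolongation *)

(** The numbering is that of [ncoord]: 0 stands for x, 2l+1 for y_l and 2l+2 for z_l, independently
    of the order of the jet space. *)
Definition jet_coord (R : realType) (u v : {poly R}) (i : nat) : {poly R} :=
  if i is j.+1 then (if odd j then v else u)^`(j./2) else 'X.

Definition imgX (R : realType) (A : 'M[R]_2) (u : {poly R}) : {poly R} :=
  A 0 0 *: 'X + A 0 1 *: u.
Definition imgY (R : realType) (A : 'M[R]_2) (u : {poly R}) : {poly R} :=
  A 1 0 *: 'X + A 1 1 *: u.
Definition imgZ (R : realType) (A : 'M[R]_2) (u v : {poly R}) : {poly R} :=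
  (A 0 0 * A 1 1 - A 0 1 * A 1 0) *: (v - 2^-1 *: ('X * u))
  + 2^-1 *: (imgX A u * imgY A u).

(** The jet of the image curve, computed from its parametrization without writing it as a graph; the
    quotient removes the factor [X'^(2l)] carried by [curve_deriv]. *)
Definition img_jet (R : realType) (A : 'M[R]_2) (u v : {poly R}) (t : R)
    (i : nat) : R :=
  if i is j.+1 then
    (curve_deriv (imgX A u) j./2 (if odd j then imgZ A u v else imgY A u)).[t]
    / (imgX A u)^`().[t] ^+ (j./2).*2
  else (imgX A u).[t].

Lemma jet_coord_deriv (R : realType) (u v : {poly R}) (i : nat) :
  (jet_coord u v i)^`() = if i is 0 then 1 else jet_coord u v i.+2.
Proof.
case: i => [|i]; first exact: derivX.
by rewrite /jet_coord -derivnS /= negbK.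
Qed.

Lemma is_jet_ofP (R : realType) (k : nat) (p : jet R k) (u v : {poly R}) :
  is_jet_of p u v <-> forall i, p i = (jet_coord u v i).[p (ix k)].
Proof.
split=> [puv i|puv l lk].
  case ij : (nat_of_ord i) => [|j].
    by rewrite /= hornerX; congr (p _); apply: val_inj; rewrite /= inordK.
  have jk : (j./2 <= k)%N by have := ltn_ord i; rewrite ij /ncoord; lia.
  have [pu pv] := puv _ jk; rewrite /=; case: ifP => oj.
    rewrite pv; congr (p _); apply: val_inj.
    by rewrite /= ij inordK /ncoord; lia.
  rewrite pu; congr (p _); apply: val_inj.
  by rewrite /= ij inordK /ncoord; lia.
rewrite (puv (iy k l)) (puv (iz k l)) /= !inordK /ncoord; try lia.
by rewrite /= odd_double doubleK uphalf_double.
Qed.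

(** The auxiliary graph [(U, V)] is eliminated: contact determines its jet by [curve_deriv_contact],
    and [contact_exists] supplies one. *)
Lemma prolongP (R : realType) (k : nat) (A : 'M[R]_2) (p q : jet R k) :
  prolong A p q <->
  exists u v t, [/\ forall i, p i = (jet_coord u v i).[t],
    (imgX A u)^`().[t] != 0 & forall i, q i = img_jet A u v t i].
Proof.
have jx0 : ix k = 0%N :> nat by rewrite inordK.
split=> [[u [v [U [V [/is_jet_ofP pj /is_jet_ofP qj [qx X'0] dY dZ]]]]]|].
  exists u, v, (p (ix k)); split=> // i.
  rewrite (qj i); case ij : (nat_of_ord i) => [|j].
    by rewrite /= hornerX -qx.
  have jk : (j./2 <= k)%N by have := ltn_ord i; rewrite ij /ncoord; lia.
  rewrite /= -qx; case: ifP => _.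
    by rewrite (curve_deriv_contact dZ) // mulrC mulKf // expf_neq0.
  by rewrite (curve_deriv_contact dY) // mulrC mulKf // expf_neq0.
case=> u [v [t [pj X'0 qj]]].
have [U dY] := contact_exists (imgY A u) k.+1 X'0.
have [V dZ] := contact_exists (imgZ A u v) k.+1 X'0.
have pt : p (ix k) = t by rewrite pj jx0 /= hornerX.
have qt : q (ix k) = (imgX A u).[t] by rewrite qj jx0.
exists u, v, U, V; split; rewrite ?pt ?qt //; apply/is_jet_ofP.
  by rewrite pt.
rewrite qt => i; rewrite qj.
case ij : (nat_of_ord i) => [|j]; first by rewrite /= hornerX.
have jk : (j./2 <= k)%N by have := ltn_ord i; rewrite ij /ncoord; lia.
rewrite /=; case: ifP => _.
  by rewrite (curve_deriv_contact dZ) // mulrC mulKf // expf_neq0.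
by rewrite (curve_deriv_contact dY) // mulrC mulKf // expf_neq0.
Qed.

Lemma unitmx2_inverse (R : comUnitRingType) (A : 'M[R]_2) : A \in unitmx ->
  exists B : 'M[R]_2,
  [/\ A 0 0 * B 0 0 + A 0 1 * B 1 0 = 1, A 0 0 * B 0 1 + A 0 1 * B 1 1 = 0,
      A 1 0 * B 0 0 + A 1 1 * B 1 0 = 0 & A 1 0 * B 0 1 + A 1 1 * B 1 1 = 1].
Proof.
move=> /mulmxV/matrixP AB; exists (invmx A).
by split; [have := AB 0 0|have := AB 0 1|have := AB 1 0|have := AB 1 1];
  rewrite !mxE !big_ord_recl big_ord0 addr0 /=; 
  have -> : lift ord0 ord0 = 1 :> 'I_2 by apply: val_inj.
Qed.

(** The preimage is the image of [(U, V)] under the inverse matrix [B], rewritten as a graph. The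
    numbers [c] and [d] form the first row of [B], so [c + d U'(s) != 0] is the transversality of
    that image. *)
Lemma img_jet_onto (R : realType) (A : 'M[R]_2) : A \in unitmx ->
  exists c d : R, [/\ (c != 0) || (d != 0) &
  forall (U V : {poly R}) (s : R) (n : nat), c + d * U^`().[s] != 0 ->
  exists u v t, (imgX A u)^`().[t] != 0 /\
  forall i, (i < n)%N -> img_jet A u v t i = (jet_coord U V i).[s]].
Proof.
move=> /unitmx2_inverse[B [AB00 AB01 AB10 AB11]].
exists (B 0 0), (B 0 1); split.
  apply: contra_eqT AB00; rewrite negb_or !negbK => /andP[/eqP B0 /eqP B1].
  apply/eqP => AB00; have := AB00; have := AB01.
  rewrite B0 B1 !mulr0 !add0r => /eqP; rewrite mulf_eq0 => /orP[/eqP ->|/eqP B11].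
    by rewrite mul0r => /esym/eqP; rewrite oner_eq0.
  by move: AB11; rewrite B1 B11 !mulr0 add0r => /esym/eqP; rewrite oner_eq0.
move=> U V s n.
pose xi := imgX B U; pose eta := imgY B U; pose zeta := imgZ B U V.
have xi'E : xi^`() = (B 0 0)%:P + B 0 1 *: U^`().
  by rewrite /xi /imgX derivD !derivZ derivX alg_polyC.
move=> nz; have xi'0 : xi^`().[s] != 0 by rewrite xi'E !hornerE.
(* With exponent [n.+2] the errors vanish at least to second order, so that values and first
   derivatives at [s] are unaffected. *)
have [u /dvdpP[e1 E1]] := contact_exists eta n.+2 xi'0.
have [v /dvdpP[e2 E2]] := contact_exists zeta n.+2 xi'0.
set M := ('X - s%:P) ^+ n.+2 in E1 E2.
have uE : u \Po xi = eta - e1 * M by rewrite -E1; ring.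
have vE : v \Po xi = zeta - e2 * M by rewrite -E2; ring.
have XE : imgX A u \Po xi = 'X - (A 0 1 *: e1) * M.
  rewrite /imgX comp_polyD !comp_polyZ comp_polyX uE /xi /eta /imgX /imgY.
  rewrite -[X in _ = X - _]scale1r -[X in _ = X - _]addr0 -[X in _ = _ + X - _](scale0r U).
  rewrite -AB00 -AB01 -!mul_polyC !polyCD !polyCM; ring.
have YE : imgY A u \Po xi = U - (A 1 1 *: e1) * M.
  rewrite /imgY comp_polyD !comp_polyZ comp_polyX uE /xi /eta /imgX /imgY.
  rewrite -[X in _ = X - _]scale1r -[X in _ = X - _]add0r -[X in _ = X + _ - _](scale0r 'X).
  rewrite -AB10 -AB11 -!mul_polyC !polyCD !polyCM; ring.
(* The third component returns to [V] because det A det B = 1. *)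
have [e3 ZE] : exists e3, imgZ A u v \Po xi = V - e3 * M.
  pose D := A 0 0 * A 1 1 - A 0 1 * A 1 0; pose D' := B 0 0 * B 1 1 - B 0 1 * B 1 0.
  have DD : D%:P * D'%:P = 1 :> {poly R}.
    rewrite -polyCM; congr (_ %:P); transitivity
      ((A 0 0 * B 0 0 + A 0 1 * B 1 0) * (A 1 0 * B 0 1 + A 1 1 * B 1 1)
       - (A 0 0 * B 0 1 + A 0 1 * B 1 1) * (A 1 0 * B 0 0 + A 1 1 * B 1 0)).
      by rewrite /D /D'; ring.
    by rewrite AB00 AB01 AB10 AB11; ring.
  pose h : {poly R} := (2^-1)%:P.
  have zE : zeta = D'%:P * (V - h * ('X * U)) + h * (xi * eta).
    by rewrite /zeta /imgZ !mul_polyC.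
  exists (D%:P * (e2 - h * (xi * e1)) + h * ((A 1 1 *: e1) * 'X + (A 0 1 *: e1) * U
    - (A 0 1 *: e1) * (A 1 1 *: e1) * M)).
  rewrite /imgZ -/D comp_polyD !comp_polyZ comp_polyM XE YE comp_polyB comp_polyZ.
  rewrite comp_polyM comp_polyX uE vE zE -![_ *: (_ - _)]mul_polyC.
  rewrite -![2^-1 *: _]mul_polyC -/h; apply/eqP; rewrite -subr_eq0.
  rewrite [X in X == 0](_ : _ = (D%:P * D'%:P - 1) * (V - h * ('X * U))); last by ring.
  by rewrite DD subrr mul0r.
have M0 e : (e * M).[s] = 0 by rewrite /M exprS !hornerM hornerXsubC subrr mul0r mulr0.
have M'0 e : (e * M)^`().[s] = 0.
  have : ('X - s%:P) ^+ n.+1 %| (e * M)^`() by apply: dvdp_deriv_XsubC; apply: dvdp_mull.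
  by case/dvdpP => q ->; rewrite exprS !hornerM hornerXsubC subrr mul0r mulr0.
(* [imgX A u] inverts [xi] to first order at [s], so its derivative cannot vanish there. *)
have X'xi : (imgX A u)^`().[xi.[s]] * xi^`().[s] = 1.
  have := congr1 (fun p => p^`().[s]) XE.
  rewrite deriv_comp hornerM horner_comp => ->.
  by rewrite derivB derivX hornerD hornerN M'0 subr0 hornerE.
have X'0 : (imgX A u)^`().[xi.[s]] != 0.
  by apply: contra_eqN X'xi => /eqP ->; rewrite mul0r eq_sym oner_eq0.
have Xs : (imgX A u).[xi.[s]] = s.
  by rewrite -horner_comp XE hornerD hornerN M0 subr0 hornerX.
have contact E W e : E \Po xi = W - e * M ->
    ('X - xi.[s]%:P) ^+ n.+2 %| E - (W \Po imgX A u).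
  move=> EE; apply: dvdp_comp_simple => //.
  rewrite comp_polyB -comp_polyA EE XE -/M.
  rewrite addrAC; apply: dvdp_sub; last exact: dvdp_mull.
  have d1 : M %| 'X - ('X - A 0 1 *: e1 * M) by rewrite opprB addrC subrK dvdp_mull.
  by have := dvdp_trans d1 (dvdp_sub_comp W _ _); rewrite comp_polyXr.
exists u, v, (xi.[s]); split=> // -[|i] ik /=; first by rewrite hornerX.
have jk : (i./2 <= n.+1)%N by lia.
case: ifP => _.
  by rewrite (curve_deriv_contact (contact _ _ _ ZE)) // Xs mulrC mulKf // expf_neq0.
by rewrite (curve_deriv_contact (contact _ _ _ YE)) // Xs mulrC mulKf // expf_neq0.
Qed.

(** * Functions of jets along curves *)

Definition along (R : realType) (n : nat) (P : {mpoly R[n]}) (u v : {poly R}) :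
    {poly R} :=
  mmap polyC (fun i : 'I_n => jet_coord u v i) P.

Lemma alongC (R : realType) (n : nat) (c : R) (u v : {poly R}) :
  along (c%:MP : {mpoly R[n]}) u v = c%:P.
Proof. exact: mmapC. Qed.

Lemma along_var (R : realType) (n : nat) (i : 'I_n) (u v : {poly R}) :
  along 'X_i u v = jet_coord u v i.
Proof. by rewrite /along mmapX mmap1U. Qed.

Lemma along0 (R : realType) (n : nat) (u v : {poly R}) :
  along (0 : {mpoly R[n]}) u v = 0.
Proof. exact: raddf0. Qed.

Lemma alongD (R : realType) (n : nat) (P Q : {mpoly R[n]}) (u v : {poly R}) :
  along (P + Q) u v = along P u v + along Q u v.
Proof. exact: raddfD. Qed.

Lemma alongB (R : realType) (n : nat) (P Q : {mpoly R[n]}) (u v : {poly R}) :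
  along (P - Q) u v = along P u v - along Q u v.
Proof. exact: raddfB. Qed.

Lemma alongM (R : realType) (n : nat) (P Q : {mpoly R[n]}) (u v : {poly R}) :
  along (P * Q) u v = along P u v * along Q u v.
Proof. exact: rmorphM. Qed.

Lemma alongX (R : realType) (n m : nat) (P : {mpoly R[n]}) (u v : {poly R}) :
  along (P ^+ m) u v = along P u v ^+ m.
Proof. exact: rmorphXn. Qed.

Lemma horner_along (R : realType) (n : nat) (P : {mpoly R[n]}) (u v : {poly R})
    (t : R) :
  (along P u v).[t] = P.@[fun i => (jet_coord u v i).[t]].
Proof. exact: horner_mmap. Qed.

(** The coordinate x doubles as the parameter, so the jet [w] is attained at the parameter value
    [w 0]. *)
Lemma jet_realised (R : realType) (n : nat) (w : nat -> R) :
  exists u v : {poly R}, forall i, (i < n)%N -> (jet_coord u v i).[w 0%N] = w i.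
Proof.
have [u uE] := poly_with_derivatives (fun l => w l.*2.+1) (w 0%N) n.
have [v vE] := poly_with_derivatives (fun l => w l.*2.+2) (w 0%N) n.
exists u, v => -[|i] lin /=; first by rewrite hornerX.
case: ifP => oi; first by rewrite vE; [congr w; lia|lia].
by rewrite uE; [congr w; lia|lia].
Qed.

Lemma along_eq0 (R : realType) (n : nat) (P : {mpoly R[n]}) :
  (forall u v, along P u v = 0) -> P = 0.
Proof.
move=> P0; apply: mpoly_fun_eq0 => w.
(* With no coordinates at all there is no base point, and any curve will do. *)
case: n => [|n] in P w P0 *.
  have := congr1 (horner^~ 0) (P0 0 0); rewrite horner0 horner_along => <-.
  by apply: meval_eq => -[].
have [u [v uvw]] := jet_realised n.+1 (fun i => w (inord i)).
have := congr1 (horner^~ (w (inord 0))) (P0 u v); rewrite horner0 horner_along.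
by move=> <-; apply: meval_eq => i; rewrite uvw // inord_val.
Qed.

Lemma along_inj (R : realType) (n : nat) (P Q : {mpoly R[n]}) :
  (forall u v, along P u v = along Q u v) -> P = Q.
Proof.
move=> PQ; apply/eqP; rewrite -subr_eq0; apply/eqP/along_eq0 => u v.
by rewrite alongB PQ subrr.
Qed.

Lemma along_neq0 (R : realType) (n : nat) (P : {mpoly R[n]}) :
  P != 0 -> exists u v, along P u v != 0.
Proof.
move=> P0; apply: boolp.contrapT => nP; move/eqP: P0; apply; apply: along_eq0 => u v.
by apply/eqP/negPn/negP => Puv; apply: nP; exists u, v.
Qed.

(** Polynomials in jet coordinates, seen through their values along curves. The bound [n] counts
    coordinates rather than orders, which separates y_l from z_l as the triangular system
    requires. *)
Definition jet_fun (R : realType) (n : nat)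
    (F : {poly R} -> {poly R} -> {poly R}) : Prop :=
  exists P : {mpoly R[n]}, forall u v, F u v = along P u v.

Lemma jet_fun_along (R : realType) (n : nat) (P : {mpoly R[n]}) :
  jet_fun n (along P).
Proof. by exists P. Qed.

Lemma jet_fun_const (R : realType) (n : nat) (c : R) : jet_fun n (fun _ _ => c%:P).
Proof. by exists c%:MP => u v; rewrite alongC. Qed.

Lemma jet_fun_coord (R : realType) (n i : nat) :
  (i < n)%N -> jet_fun n (fun u v : {poly R} => jet_coord u v i).
Proof.
by move=> lin; exists 'X_(Ordinal lin) => u v; rewrite along_var.
Qed.

Lemma jet_funD (R : realType) (n : nat) (F G : {poly R} -> {poly R} -> {poly R}) :
  jet_fun n F -> jet_fun n G -> jet_fun n (fun u v => F u v + G u v).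
Proof.
by case=> P FP [Q GQ]; exists (P + Q) => u v; rewrite FP GQ alongD.
Qed.

Lemma jet_funN (R : realType) (n : nat) (F : {poly R} -> {poly R} -> {poly R}) :
  jet_fun n F -> jet_fun n (fun u v => - F u v).
Proof. by case=> P FP; exists (- P) => u v; rewrite FP /along mmapN. Qed.

Lemma jet_funM (R : realType) (n : nat) (F G : {poly R} -> {poly R} -> {poly R}) :
  jet_fun n F -> jet_fun n G -> jet_fun n (fun u v => F u v * G u v).
Proof.
by case=> P FP [Q GQ]; exists (P * Q) => u v; rewrite FP GQ alongM.
Qed.

Lemma jet_funX (R : realType) (n m : nat) (F : {poly R} -> {poly R} -> {poly R}) :
  jet_fun n F -> jet_fun n (fun u v => F u v ^+ m).
Proof. by case=> P FP; exists (P ^+ m) => u v; rewrite FP alongX. Qed.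

Lemma jet_funMn (R : realType) (n m : nat) (F : {poly R} -> {poly R} -> {poly R}) :
  jet_fun n F -> jet_fun n (fun u v => F u v *+ m).
Proof. by case=> P FP; exists (P *+ m) => u v; rewrite FP /along mmapMn. Qed.

Lemma jet_funZ (R : realType) (n : nat) (c : R)
    (F : {poly R} -> {poly R} -> {poly R}) :
  jet_fun n F -> jet_fun n (fun u v => c *: F u v).
Proof.
by case=> P FP; exists (c *: P) => u v; rewrite FP /along mmapZ mul_polyC.
Qed.

Lemma jet_fun_widen (R : realType) (n m : nat)
    (F : {poly R} -> {poly R} -> {poly R}) :
  (n <= m)%N -> jet_fun n F -> jet_fun m F.
Proof.
move=> nm [P FP].
exists (mmap (@mpolyC m R) (fun i => 'X_(widen_ord nm i)) P) => u v; rewrite FP.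
apply/eqP; rewrite -subr_eq0; apply/eqP/poly_fun_eq0 => t.
rewrite hornerD hornerN !horner_along meval_mmap; apply/eqP; rewrite subr_eq0.
by apply/eqP/meval_eq => i; rewrite mevalXU.
Qed.

Lemma jet_fun_sum (R : realType) (n : nat) (I : Type) (r : seq I)
    (F : I -> {poly R} -> {poly R} -> {poly R}) :
  (forall i, jet_fun n (F i)) -> jet_fun n (fun u v => \sum_(i <- r) F i u v).
Proof.
move=> jF; elim: r => [|i r [Q QE]].
  by exists 0 => u v; rewrite big_nil along0.
have [P PE] := jF i; exists (P + Q) => u v.
by rewrite big_cons PE QE alongD.
Qed.

Lemma jet_fun_deriv (R : realType) (n : nat)
    (F : {poly R} -> {poly R} -> {poly R}) :
  jet_fun n F -> jet_fun n.+2 (fun u v => (F u v)^`()).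
Proof.
case=> P FP.
suff [Q QE] : jet_fun n.+2 (fun u v => \sum_(i < n)
    (jet_coord u v i)^`() * along P^`M(i) u v).
  by exists Q => u v; rewrite FP -QE deriv_mmap.
apply: jet_fun_sum => i; apply: jet_funM; last first.
  exact: (jet_fun_widen (leqW (leqnSn n)) (jet_fun_along _)).
have [Q QE] : jet_fun n.+2 (fun u v : {poly R} =>
    if (i : nat) is 0 then 1 else jet_coord u v i.+2).
  case ij : (nat_of_ord i) => [|j]; first by apply: (jet_fun_const _ 1).
  by apply: jet_fun_coord; rewrite -ij !ltnS.
by exists Q => u v; rewrite jet_coord_deriv -QE.
Qed.

Definition jet_poly (R : realType) (F : {poly R} -> {poly R} -> {poly R}) : Prop :=
  exists n, jet_fun n F.

Lemma jet_poly_common (R : realType) (F G : {poly R} -> {poly R} -> {poly R}) :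
  jet_poly F -> jet_poly G -> exists n, jet_fun n F /\ jet_fun n G.
Proof.
move=> [n jF] [m jG]; exists (maxn n m).
by split; [apply: jet_fun_widen jF|apply: jet_fun_widen jG];
  rewrite ?leq_maxl ?leq_maxr.
Qed.

Lemma jet_poly_along (R : realType) (n : nat) (P : {mpoly R[n]}) :
  jet_poly (along P).
Proof. by exists n; apply: jet_fun_along. Qed.

Lemma jet_poly_const (R : realType) (c : R) : jet_poly (fun _ _ => c%:P).
Proof. by exists 0%N; apply: jet_fun_const. Qed.

Lemma jet_poly_coord (R : realType) (i : nat) :
  jet_poly (fun u v : {poly R} => jet_coord u v i).
Proof. by exists i.+1; apply: jet_fun_coord. Qed.

Lemma jet_polyD (R : realType) (F G : {poly R} -> {poly R} -> {poly R}) :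
  jet_poly F -> jet_poly G -> jet_poly (fun u v => F u v + G u v).
Proof.
by move=> jF jG; have [n [? ?]] := jet_poly_common jF jG; exists n; apply: jet_funD.
Qed.

Lemma jet_polyN (R : realType) (F : {poly R} -> {poly R} -> {poly R}) :
  jet_poly F -> jet_poly (fun u v => - F u v).
Proof. by case=> n jF; exists n; apply: jet_funN. Qed.

Lemma jet_polyM (R : realType) (F G : {poly R} -> {poly R} -> {poly R}) :
  jet_poly F -> jet_poly G -> jet_poly (fun u v => F u v * G u v).
Proof.
by move=> jF jG; have [n [? ?]] := jet_poly_common jF jG; exists n; apply: jet_funM.
Qed.

Lemma jet_polyX (R : realType) (m : nat) (F : {poly R} -> {poly R} -> {poly R}) :
  jet_poly F -> jet_poly (fun u v => F u v ^+ m).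
Proof. by case=> n jF; exists n; apply: jet_funX. Qed.

Lemma jet_polyMn (R : realType) (m : nat) (F : {poly R} -> {poly R} -> {poly R}) :
  jet_poly F -> jet_poly (fun u v => F u v *+ m).
Proof. by case=> n jF; exists n; apply: jet_funMn. Qed.

Lemma jet_polyZ (R : realType) (c : R) (F : {poly R} -> {poly R} -> {poly R}) :
  jet_poly F -> jet_poly (fun u v => c *: F u v).
Proof. by case=> n jF; exists n; apply: jet_funZ. Qed.

Lemma jet_poly_deriv (R : realType) (F : {poly R} -> {poly R} -> {poly R}) :
  jet_poly F -> jet_poly (fun u v => (F u v)^`()).
Proof. by case=> n jF; exists n.+2; apply: jet_fun_deriv. Qed.

(** Polynomials in jet coordinates form an integral domain, so generic conditions met on different
    curves can be met on a common one. *)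
Lemma jet_poly_mulf_neq0 (R : realType) (F G : {poly R} -> {poly R} -> {poly R}) :
  jet_poly F -> jet_poly G -> (exists u v, F u v != 0) -> (exists u v, G u v != 0) ->
  exists u v, F u v * G u v != 0.
Proof.
move=> jF jG [u1 [v1 F1]] [u2 [v2 G2]].
have [n [[P FP] [Q GQ]]] := jet_poly_common jF jG.
have P0 : P != 0 by apply: contraNneq F1 => P0; rewrite FP P0 along0.
have Q0 : Q != 0 by apply: contraNneq G2 => Q0; rewrite GQ Q0 along0.
have [u [v PQ]] := along_neq0 (mulf_neq0 P0 Q0).
by exists u, v; rewrite FP GQ -alongM.
Qed.

Lemma jet_poly_imgX (R : realType) (A : 'M[R]_2) :
  jet_poly (fun u v : {poly R} => imgX A u).
Proof.
by apply: jet_polyD; apply: jet_polyZ;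
  [apply: (jet_poly_coord _ 0)|apply: (jet_poly_coord _ 1)].
Qed.

Lemma jet_poly_imgY (R : realType) (A : 'M[R]_2) :
  jet_poly (fun u v : {poly R} => imgY A u).
Proof.
by apply: jet_polyD; apply: jet_polyZ;
  [apply: (jet_poly_coord _ 0)|apply: (jet_poly_coord _ 1)].
Qed.

Lemma jet_poly_imgZ (R : realType) (A : 'M[R]_2) :
  jet_poly (fun u v : {poly R} => imgZ A u v).
Proof.
apply: jet_polyD; apply: jet_polyZ; last first.
  by apply: jet_polyM; [apply: jet_poly_imgX|apply: jet_poly_imgY].
apply: jet_polyD; first exact: (jet_poly_coord _ 2).
apply: jet_polyN; apply: jet_polyZ.
by apply: jet_polyM; [apply: (jet_poly_coord _ 0)|apply: (jet_poly_coord _ 1)].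
Qed.

Lemma jet_poly_curve_deriv (R : realType) (l : nat)
    (X F : {poly R} -> {poly R} -> {poly R}) :
  jet_poly X -> jet_poly F -> jet_poly (fun u v => curve_deriv (X u v) l (F u v)).
Proof.
move=> jX jF; elim: l => //= l IHl; apply: jet_polyD.
  by apply: jet_polyM; apply: jet_poly_deriv.
apply: jet_polyN; apply: jet_polyMn; apply: jet_polyM => //.
by do 2!apply: jet_poly_deriv.
Qed.

(** Stated for an abstract jet [w], so that it can be evaluated on [img_jet], which is not given by
    a graph. *)
Definition total_deriv (R : realType) (n : nat) (P : {mpoly R[n]}) (w : nat -> R) : R :=
  \sum_(i < n) (if (i : nat) is 0 then 1 else w i.+2) * P^`M(i).@[fun i => w i].

Lemma total_derivM (R : realType) (n : nat) (P Q : {mpoly R[n]}) (w : nat -> R) :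
  total_deriv (P * Q) w = total_deriv P w * Q.@[fun i => w i]
    + P.@[fun i => w i] * total_deriv Q w.
Proof.
rewrite /total_deriv mulr_suml mulr_sumr -big_split; apply: eq_bigr => i _.
by rewrite mderivM mevalD !mevalM /=; ring.
Qed.

Lemma total_derivD (R : realType) (n : nat) (P Q : {mpoly R[n]}) (w : nat -> R) :
  total_deriv (P + Q) w = total_deriv P w + total_deriv Q w.
Proof.
rewrite /total_deriv -big_split; apply: eq_bigr => i _.
by rewrite mderivD mevalD mulrDr.
Qed.

(* If [F = a^N f] then [weighted_deriv a N F = a^(N+1) f']. *)
Definition weighted_deriv (R : comNzRingType) (a : {poly R}) (N : nat) (F : {poly R}) :=
  F^`() * a - F * a^`() *+ N.

Lemma weighted_derivD (R : comNzRingType) (a F G : {poly R}) (N : nat) :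
  weighted_deriv a N (F + G) = weighted_deriv a N F + weighted_deriv a N G.
Proof. by rewrite /weighted_deriv derivD !mulrDl mulrnDl opprD addrACA. Qed.

Lemma weighted_derivM (R : comNzRingType) (a F G : {poly R}) (N M : nat) :
  weighted_deriv a (N + M) (F * G)
  = weighted_deriv a N F * G + F * weighted_deriv a M G.
Proof.
rewrite /weighted_deriv derivM mulrnDr mulrBr mulrBl mulrnAr mulrnAl.
have -> : F * a^`() * G = F * G * a^`() by ring.
have -> : F * (G * a^`()) = F * G * a^`() by ring.
ring.
Qed.

(** In weight [N] the power [a^N] represents the constant 1. *)
Lemma weighted_deriv_exp (R : comNzRingType) (a : {poly R}) (N : nat) :
  weighted_deriv a N (a ^+ N) = 0.
Proof.
case: N => [|N]; first by rewrite /weighted_deriv expr0 derivC mul0r subr0.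
rewrite /weighted_deriv deriv_exp mulrnAl exprS; apply/eqP; rewrite subr_eq0.
by apply/eqP; congr (_ *+ _); rewrite /=; ring.
Qed.

(* The second equation is the chain rule d/dt = X' D_x along the image curve. *)
Lemma img_poly (R : realType) (A : 'M[R]_2) (n : nat) (P : {mpoly R[n]}) :
  exists (N : nat) F, jet_poly F /\ forall u v t, (imgX A u)^`().[t] != 0 ->
    (F u v).[t] = (imgX A u)^`().[t] ^+ N * P.@[fun i => img_jet A u v t i] /\
    (weighted_deriv (imgX A u)^`() N (F u v)).[t]
      = (imgX A u)^`().[t] ^+ N.+2 * total_deriv P (img_jet A u v t).
Proof.
elim/mpoly_ring_ind: P => [c|i|P Q [N [F [jF FE]]] [M [G [jG GE]]]|
    P Q [N [F [jF FE]]] [M [G [jG GE]]]].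
- exists 0%N, (fun _ _ => c%:P); split=> [|u v t X'0]; first exact: jet_poly_const.
  rewrite /weighted_deriv mevalC hornerC mul1r derivC mul0r mulr0n subr0 horner0.
  rewrite /total_deriv big1 ?mulr0 // => j _.
  by rewrite mderivC meval0 mulr0.
- have dX w : total_deriv 'X_i w = if (i : nat) is 0 then 1 else w i.+2 :> R.
    rewrite /total_deriv (bigD1 i) //= big1 ?addr0 => [|j ji].
      by rewrite mderivX mnm1E eqxx scale1r -{1}[U_(i)%MM]add0m addmK mpolyX0 meval1 mulr1.
    by rewrite mderivX mnm1E eq_sym (negbTE ji) scale0r meval0 mulr0.
  case ij : (nat_of_ord i) dX => [|j] dX.
    exists 0%N, (fun u v => imgX A u); split=> [|u v t X'0]; first exact: jet_poly_imgX.
    by rewrite /weighted_deriv mevalXU dX ij /= expr0 mul1r mulr0n subr0 hornerM mulr1 expr2.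
  (* In weight [2l] the weighted derivative of the [l]-th [curve_deriv] is by definition the next
     one. *)
  exists (j./2).*2, (fun u v =>
    curve_deriv (imgX A u) j./2 (if odd j then imgZ A u v else imgY A u)).
  split=> [|u v t X'0].
    apply: jet_poly_curve_deriv; first exact: jet_poly_imgX.
    by case: (odd j); [apply: jet_poly_imgZ|apply: jet_poly_imgY].
  rewrite mevalXU dX ij /= negbK doubleS.
  by split; rewrite mulrC divfK // expf_neq0.
(* The summands are brought to a common weight by powers of [X'], which behave as constants. *)
- exists (N + M)%N, (fun u v => F u v * (imgX A u)^`() ^+ M + G u v * (imgX A u)^`() ^+ N).
  have jX m : jet_poly (fun u v : {poly R} => (imgX A u)^`() ^+ m).
    by apply: jet_polyX; apply: jet_poly_deriv; apply: jet_poly_imgX.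
  split=> [|u v t X'0]; first by apply: jet_polyD; apply: jet_polyM.
  have [FE1 FE2] := FE u v t X'0; have [GE1 GE2] := GE u v t X'0.
  rewrite mevalD total_derivD; split; first by rewrite !hornerE FE1 GE1 !exprD; ring.
  rewrite weighted_derivD weighted_derivM addnC weighted_derivM.
  rewrite !weighted_deriv_exp !mulr0 !addr0.
  rewrite hornerD !hornerM FE2 GE2 !horner_exp !exprS exprD; ring.
- exists (N + M)%N, (fun u v => F u v * G u v).
  split=> [|u v t X'0]; first exact: jet_polyM.
  have [FE1 FE2] := FE u v t X'0; have [GE1 GE2] := GE u v t X'0.
  rewrite mevalM total_derivM; split; first by rewrite hornerM FE1 GE1 !exprD; ring.
  rewrite weighted_derivM hornerD !hornerM FE1 GE1 FE2 GE2 !exprS exprD; ring.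
Qed.

(** * Rational functions of jets and their pullbacks *)

Lemma frac_repr (D : idomainType) (f : {fraction D}) :
  f = (\n_(repr f))%:F / (\d_(repr f))%:F.
Proof.
have d0 : \d_(repr f) != 0 by apply: denom_ratioP.
have d0F : (\d_(repr f))%:F != 0 by rewrite tofrac_eq0.
apply: (mulIf d0F); rewrite divfK //.
have tE y : y%:F = (\pi_{fraction D} (Ratio y 1))%qT.
  by unlock FracField.tofrac.
rewrite -{1}[f]reprK !tE -[LHS]/(FracField.mul _ _) -FracField.pi_mul.
apply/eqmodP; rewrite /= FracField.equivfE.
rewrite /FracField.mulf !numden_Ratio ?mulf_neq0 ?oner_neq0 //.
by rewrite !mulr1 mulrC.
Qed.

Lemma divF_eq (D : idomainType) (P Q P' Q' : D) : Q != 0 -> Q' != 0 ->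
  (P%:F / Q%:F = P'%:F / Q'%:F) <-> (P * Q' = P' * Q).
Proof.
move=> Q0 Q'0; have QF : Q%:F != 0 by rewrite tofrac_eq0.
have Q'F : Q'%:F != 0 by rewrite tofrac_eq0.
split=> [/eqP|PQ]; first by rewrite eqr_div // -!tofracM tofrac_eq => /eqP.
by apply/eqP; rewrite eqr_div // -!tofracM PQ.
Qed.

Lemma poly_neq0_fun (R : numDomainType) (p : {poly R}) :
  p != 0 -> exists t, p.[t] != 0.
Proof.
move=> p0; apply: boolp.contrapT => np; move/eqP: p0; apply; apply: poly_fun_eq0 => t.
by apply/eqP/negPn/negP => pt; apply: np; exists t.
Qed.

(** Nonvanishing at the image is a generic condition: a target jet with [D != 0], transversal for
    the inverse transformation, is taken back by [img_jet_onto]. *)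
Lemma img_neq0 (R : realType) (A : 'M[R]_2) (n : nat) (D : {mpoly R[n]}) :
  A \in unitmx -> D != 0 -> exists u v t,
  (imgX A u)^`().[t] != 0 /\ D.@[fun i => img_jet A u v t i] != 0.
Proof.
move=> /img_jet_onto[c [d [cd onto]]] D0.
have jX : jet_poly (fun u v : {poly R} => c%:P + d *: (jet_coord u v 1)^`()).
  apply: jet_polyD; first exact: jet_poly_const.
  by apply: jet_polyZ; apply: jet_poly_deriv; apply: jet_poly_coord.
have X0 : exists u v : {poly R}, c%:P + d *: (jet_coord u v 1)^`() != 0.
  have [c0|c0] := eqVneq c 0.
    exists 'X, 0; rewrite /= derivX c0 add0r alg_polyC polyC_eq0.
    by move: cd; rewrite c0 eqxx.
  by exists 0, 0; rewrite /= deriv0 scaler0 addr0 polyC_eq0.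
have [U [V UV]] := jet_poly_mulf_neq0 (jet_poly_along D) jX (along_neq0 D0) X0.
have [s] := poly_neq0_fun UV.
rewrite hornerM mulf_eq0 negb_or => /andP[Ds].
rewrite !hornerE => /(onto U V s n)[u [v [t [X'0 ut]]]].
exists u, v, t; split=> //; move: Ds; rewrite horner_along.
by congr (_ != 0); apply: meval_eq => i; rewrite ut.
Qed.

(** A density argument: multiplied by powers of [X'], the difference of the sides becomes a jet
    polynomial [G]. Were it nonzero, it would be nonzero at a point where all generic conditions
    hold. *)
Lemma img_identity (R : realType) (A : 'M[R]_2) (n m l : nat)
    (P1 P2 : {mpoly R[n]}) (Q1 Q2 : {mpoly R[m]}) (D : {mpoly R[l]})
    (H : {poly R} -> {poly R} -> {poly R}) :
  A \in unitmx -> D != 0 -> jet_poly H -> (exists u v, H u v != 0) ->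
  (forall u v t, (imgX A u)^`().[t] != 0 ->
    D.@[fun i => img_jet A u v t i] != 0 -> (H u v).[t] != 0 ->
    P1.@[fun i => img_jet A u v t i] * (along Q2 u v).[t]
    = (along Q1 u v).[t] * P2.@[fun i => img_jet A u v t i]) ->
  forall u v t, (imgX A u)^`().[t] != 0 ->
    P1.@[fun i => img_jet A u v t i] * (along Q2 u v).[t]
    = (along Q1 u v).[t] * P2.@[fun i => img_jet A u v t i].
Proof.
move=> uA D0 jH H0 generic u v t X'0.
have [N1 [F1 [jF1 F1E]]] := img_poly A P1.
have [N2 [F2 [jF2 F2E]]] := img_poly A P2.
have [N3 [F3 [jF3 F3E]]] := img_poly A D.
have jX' : jet_poly (fun u v : {poly R} => (imgX A u)^`()).
  by apply: jet_poly_deriv; apply: jet_poly_imgX.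
pose G u v := F1 u v * along Q2 u v * (imgX A u)^`() ^+ N2
  - along Q1 u v * F2 u v * (imgX A u)^`() ^+ N1.
have GE w z s : (imgX A w)^`().[s] != 0 -> (G w z).[s]
  = (imgX A w)^`().[s] ^+ (N1 + N2) *
    (P1.@[fun i => img_jet A w z s i] * (along Q2 w z).[s]
      - (along Q1 w z).[s] * P2.@[fun i => img_jet A w z s i]).
  move=> X'; have [E1 _] := F1E w z s X'; have [E2 _] := F2E w z s X'.
  rewrite /G hornerD hornerN !hornerM !horner_exp E1 E2 exprD; ring.
have G0 w z : G w z = 0.
  apply/eqP/negPn/negP => Gwz.
  have [u0 [v0 [t0 [X't0 Dt0]]]] := img_neq0 uA D0.
  have F30 : exists u v, F3 u v * (imgX A u)^`() != 0.
    exists u0, v0; apply: contraNneq Dt0 => /(congr1 (horner^~ t0)).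
    rewrite horner0 hornerM => /eqP; rewrite mulf_eq0 (negbTE X't0) orbF.
    by have [-> _] := F3E u0 v0 t0 X't0; rewrite mulf_eq0 expf_eq0 (negbTE X't0) andbF.
  have jG : jet_poly G.
    apply: jet_polyD; [|apply: jet_polyN]; (apply: jet_polyM; last exact: jet_polyX);
      by apply: jet_polyM => //; apply: jet_poly_along.
  have K0 := jet_poly_mulf_neq0 (jet_polyM jF3 jX') jH F30 H0.
  have jK := jet_polyM (jet_polyM jF3 jX') jH.
  have [u1 [v1 GK]] := jet_poly_mulf_neq0 jG jK (ex_intro _ w (ex_intro _ z Gwz)) K0.
  have [t1] := poly_neq0_fun GK; rewrite !hornerM !mulf_eq0 !negb_or.
  case/andP=> G1 /andP[/andP[F31 X'1] H1].
  case/eqP: G1; rewrite GE // generic ?subrr ?mulr0 //.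
  apply: contraNneq F31 => D1; have [-> _] := F3E u1 v1 t1 X'1.
  by rewrite D1 mulr0.
have := GE u v t X'0; rewrite G0 horner0 => /esym/eqP.
by rewrite mulf_eq0 expf_eq0 (negbTE X'0) andbF /= subr_eq0 => /eqP.
Qed.

(** [is_pullback] concerns all points and all fractions representing [f] and [g]. One fraction for
    each, tested at generic points, suffices: other fractions agree after cross-multiplication, and
    [img_identity] removes the genericity. *)
Lemma is_pullback_criterion (R : realType) (A : 'M[R]_2) (k : nat)
    (f g : jetrat R k) (n1 d1 n2 d2 : jetpoly R k)
    (H : {poly R} -> {poly R} -> {poly R}) :
  A \in unitmx -> d1 != 0 -> d2 != 0 ->
  f = n1%:F / d1%:F -> g = n2%:F / d2%:F ->
  jet_poly H -> (exists u v, H u v != 0) ->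
  (forall u v t, (imgX A u)^`().[t] != 0 -> (H u v).[t] != 0 ->
    n1.@[fun i => img_jet A u v t i] * (along d2 u v).[t]
    = (along n2 u v).[t] * d1.@[fun i => img_jet A u v t i]) ->
  is_pullback A f g.
Proof.
move=> uA d10 d20 fE gE jH H0 generic p q /prolongP[u [v [t [pE X'0 qE]]]].
move=> c c' [P [Q [Qq fPQ ->]]] [P' [Q' [Q'p gPQ' ->]]].
have Q0 : Q != 0 by apply: contraNneq Qq => ->; rewrite meval0.
have Q'0 : Q' != 0 by apply: contraNneq Q'p => ->; rewrite meval0.
have /divF_eq E1 : n1%:F / d1%:F = P%:F / Q%:F by rewrite -fE.
have /divF_eq E2 : n2%:F / d2%:F = P'%:F / Q'%:F by rewrite -gE.
have {}E1 := E1 d10 Q0; have {}E2 := E2 d20 Q'0.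
have pm (S : jetpoly R k) : S.@[p] = (along S u v).[t].
  by rewrite horner_along; apply: meval_eq.
have qm (S : jetpoly R k) : S.@[q] = S.@[fun i => img_jet A u v t i].
  exact: meval_eq.
apply/eqP; rewrite eqr_div // !pm !qm; apply/eqP; move: t X'0 {pE qE pm qm Qq Q'p}.
move=> t X'0; have jHd := jet_polyM jH (jet_poly_along d2).
have Hd0 := jet_poly_mulf_neq0 jH (jet_poly_along d2) H0 (along_neq0 d20).
apply: (img_identity uA d10 jHd Hd0) X'0 => {}u {}v {}t X'0 d1q.
rewrite hornerM mulf_eq0 negb_or => /andP[Ht d2p].
have {generic} := generic u v t X'0 Ht.
move: d1q d2p (congr1 (meval (fun i => img_jet A u v t i)) E1)
  (congr1 (meval (fun i : 'I__ => (jet_coord u v i).[t])) E2).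
rewrite !mevalM !horner_along; set dq := meval _ d1; set dp := meval _ d2.
move=> dq0 dp0 e1 e2 e; apply: (mulIf dq0); apply: (mulIf dp0).
move: e1 e2 e; move: (meval _ n1) (meval _ Q) (meval _ P) => x1 x2 x3.
move: (meval _ n2) (meval _ Q') (meval _ P') => y1 y2 y3 e1 e2 e3.
transitivity (x3 * dq * y2 * dp); first by ring.
rewrite -e1; transitivity (x1 * dp * x2 * y2); first by ring.
rewrite e3; transitivity (y1 * y2 * x2 * dq); first by ring.
rewrite e2; ring.
Qed.

Lemma along_lift (R : realType) (k K : nat) (P : jetpoly R k) (u v : {poly R}) :
  (k <= K)%N -> along (poly_lift K P) u v = along P u v.
Proof.
move=> kK; apply/eqP; rewrite -subr_eq0; apply/eqP/poly_fun_eq0 => t.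
rewrite hornerD hornerN !horner_along meval_mmap; apply/eqP; rewrite subr_eq0.
apply/eqP/meval_eq => i; rewrite mevalXU inordK //.
by apply: leq_trans (ltn_ord i) _; rewrite /ncoord; lia.
Qed.

Lemma poly_lift_neq0 (R : realType) (k K : nat) (P : jetpoly R k) :
  (k <= K)%N -> P != 0 -> poly_lift K P != 0.
Proof.
move=> kK; apply: contraNneq => P0; apply/eqP/along_eq0 => u v.
by rewrite -(along_lift P u v kK) P0 along0.
Qed.

Lemma along_Dpoly (R : realType) (k : nat) (P : jetpoly R k) (u v : {poly R}) :
  along (Dpoly P) u v = (along P u v)^`().
Proof.
rewrite deriv_mmap /Dpoly /along rmorph_sum; apply: eq_bigr => i _.
rewrite [LHS]alongM along_lift // jet_coord_deriv; congr (_ * _).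
case: eqP => [->|/eqP ix]; first by rewrite inordK // [LHS]rmorph1.
have : (i : nat) != 0%N.
  by apply: contraNneq ix => i0; apply/eqP/val_inj; rewrite /= inordK.
case ij : (nat_of_ord i) => [//|j] _; rewrite along_var inordK //.
by have := ltn_ord i; rewrite ij /ncoord; lia.
Qed.

(** Describing a fraction by numerator and denominator along curves avoids the chosen
    representatives [repr] and turns calculations into identities of univariate polynomials. *)
Definition represented (R : realType) (k : nat) (f : jetrat R k)
    (F G : {poly R} -> {poly R} -> {poly R}) : Prop :=
  exists P Q : jetpoly R k, [/\ Q != 0, f = P%:F / Q%:F,
    forall u v, along P u v = F u v & forall u v, along Q u v = G u v].

Lemma represented_repr (R : realType) (k : nat) (f : jetrat R k) :
  represented f (along (\n_(repr f))) (along (\d_(repr f))).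
Proof.
by exists (\n_(repr f)), (\d_(repr f)); split=> //;
  [apply: denom_ratioP|apply: frac_repr].
Qed.

(** [rat_lift] uses a chosen representative; the choice is immaterial, as lifting preserves
    cross-multiplied identities. *)
Lemma represented_lift (R : realType) (k K : nat) (f : jetrat R k) F G :
  (k <= K)%N -> represented f F G -> represented (rat_lift K f) F G.
Proof.
move=> kK [P [Q [Q0 fE PF QG]]]; exists (poly_lift K P), (poly_lift K Q).
split=> [|||]; try by move=> u v; rewrite along_lift.
  exact: poly_lift_neq0.
rewrite /rat_lift; set n := \n_ _; set d := \d_ _.
have d0 : d != 0 by apply: denom_ratioP.
apply/(divF_eq _ _ (poly_lift_neq0 kK d0) (poly_lift_neq0 kK Q0)).
have /divF_eq E : n%:F / d%:F = P%:F / Q%:F by rewrite -fE -frac_repr.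
apply: along_inj => u v; by rewrite !alongM !along_lift // -!alongM E.
Qed.

(** The quotient rule. Independence of the chosen representative follows by differentiating the
    cross-multiplied identity along curves. *)
Lemma represented_derivation (R : realType) (r k : nat) (s : jetrat R r)
    (f : jetrat R k) S T F G :
  (r <= k.+1)%N -> represented s S T -> represented f F G ->
  represented (derivation s f)
    (fun u v => S u v * ((F u v)^`() * G u v - F u v * (G u v)^`()))
    (fun u v => T u v * G u v ^+ 2).
Proof.
move=> rk /(represented_lift rk)[P1 [Q1 [Q10 sE P1S Q1T]]] [P [Q [Q0 fE PF QG]]].
exists (P1 * (Dpoly P * poly_lift k.+1 Q - poly_lift k.+1 P * Dpoly Q)).
exists (Q1 * poly_lift k.+1 Q ^+ 2); split.
- by rewrite mulf_neq0 // expf_neq0 // poly_lift_neq0.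
- rewrite /derivation sE /Dx; set n := \n_ _; set d := \d_ _.
  have d0 : d != 0 by apply: denom_ratioP.
  have /divF_eq E : n%:F / d%:F = P%:F / Q%:F by rewrite -fE -frac_repr.
  rewrite [(P1 * _)%:F]tofracM [(Q1 * _)%:F]tofracM -mulf_div; congr (_ * _).
  have d20 : poly_lift k.+1 d ^+ 2 != 0 by rewrite expf_neq0 // poly_lift_neq0.
  have Q20 : poly_lift k.+1 Q ^+ 2 != 0 by rewrite expf_neq0 // poly_lift_neq0.
  apply/(divF_eq _ _ d20 Q20); apply: along_inj => u v.
  rewrite !(alongM, alongB, alongX) !along_Dpoly.
  rewrite !(along_lift _ _ _ (leqnSn k)).
  have {}E : along n u v * along Q u v = along P u v * along d u v.
    by rewrite -!alongM E.
  have := congr1 (@deriv _) E; rewrite !derivM; move: E.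
  move: (along n u v) (along Q u v) (along P u v) (along d u v) => x y z w E.
  move: (x^`()) (y^`()) (z^`()) (w^`()) => x' y' z' w' E'.
  transitivity (x' * y * (w * y) - x * y * (w' * y)); first by ring.
  have -> : x' * y = z' * w + z * w' - x * y' by rewrite -E'; ring.
  rewrite E; transitivity (z' * y * w ^+ 2 - x * y * y' * w); last by rewrite E; ring.
  ring.
- by move=> u v; rewrite !(alongM, alongB) !along_Dpoly !along_lift // P1S PF QG.
- by move=> u v; rewrite alongM alongX !along_lift // Q1T QG.
Qed.

(** * Invariance of the generators *)

(** [delta] is the determinant of position (x, y) and velocity (1, y_1); [area] is twice z - xy/2, a
    function that [Phi A] multiplies by det A. *)
Definition delta (R : realType) (u v : {poly R}) : {poly R} := 'X * u^`() - u.
Definition area (R : realType) (u v : {poly R}) : {poly R} := v *+ 2 - 'X * u.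

Definition det2 (R : realType) (A : 'M[R]_2) : R := A 0 0 * A 1 1 - A 0 1 * A 1 0.

Lemma det2_neq0 (R : realType) (A : 'M[R]_2) : (A \in unitmx) = (det2 A != 0).
Proof.
rewrite unitmxE unitfE (expand_det_row _ 0) !big_ord_recl big_ord0 addr0.
rewrite /cofactor !det_mx11 !mxE /= expr0 expr1 mul1r mulN1r mulrN /det2.
by congr (_ * A _ _ - A _ _ * A _ _ != 0); apply: val_inj.
Qed.

Lemma imgX_deriv (R : realType) (A : 'M[R]_2) (u : {poly R}) (t : R) :
  (imgX A u)^`().[t] = A 0 0 + A 0 1 * u^`().[t].
Proof. by rewrite /imgX derivD !derivZ derivX !hornerE. Qed.

Lemma img_jet3 (R : realType) (A : 'M[R]_2) (u v : {poly R}) (t : R) :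
  (imgX A u)^`().[t] != 0 ->
  img_jet A u v t 3 = (imgY A u)^`().[t] / (imgX A u)^`().[t].
Proof.
by move=> X'0; rewrite /= mulr0n subr0 hornerM expr2 invfM mulrA mulfK.
Qed.

Lemma img_jet4 (R : realType) (A : 'M[R]_2) (u v : {poly R}) (t : R) :
  (imgX A u)^`().[t] != 0 ->
  img_jet A u v t 4 = (imgZ A u v)^`().[t] / (imgX A u)^`().[t].
Proof.
by move=> X'0; rewrite /= mulr0n subr0 hornerM expr2 invfM mulrA mulfK.
Qed.

(** A linear map multiplies the determinant of position and velocity by det A; taking X as the
    parameter divides the velocity by X'. *)
Lemma img_jet_delta (R : realType) (A : 'M[R]_2) (u v : {poly R}) (t : R) :
  (imgX A u)^`().[t] != 0 ->
  img_jet A u v t 0 * img_jet A u v t 3 - img_jet A u v t 1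
  = det2 A * (delta u v).[t] / (imgX A u)^`().[t].
Proof.
move=> X'0; rewrite img_jet3 // /= expr0 divr1.
move: X'0; rewrite imgX_deriv => X'0.
rewrite /imgY /imgX /delta /det2 !(derivD, derivZ, derivX).
rewrite !(hornerD, hornerN, hornerM, hornerZ, hornerX, hornerC).
by field.
Qed.

(** z_1 - y is the contact form dz - y dx on the velocity (1, y_1, z_1), and [Phi A] multiplies this
    form by det A. *)
Lemma img_jet_slope (R : realType) (A : 'M[R]_2) (u v : {poly R}) (t : R) :
  (imgX A u)^`().[t] != 0 ->
  img_jet A u v t 4 - img_jet A u v t 1
  = det2 A * (v^`() - u).[t] / (imgX A u)^`().[t].
Proof.
move=> X'0; rewrite img_jet4 // /= expr0 divr1.
move: X'0; rewrite imgX_deriv => X'0.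
rewrite /imgZ /imgY /imgX /det2 !(derivD, derivN, derivM, derivZ, derivX).
rewrite !(hornerD, hornerN, hornerM, hornerZ, hornerX, hornerC).
by field.
Qed.

Lemma img_jet_area (R : realType) (A : 'M[R]_2) (u v : {poly R}) (t : R) :
  img_jet A u v t 2 *+ 2 - img_jet A u v t 0 * img_jet A u v t 1
  = det2 A * (area u v).[t].
Proof.
rewrite /= expr0 !divr1 /imgZ /imgY /imgX /det2 /area.
rewrite !(hornerD, hornerN, hornerMn, hornerM, hornerZ, hornerX, hornerC).
by field.
Qed.

(** For a parametrized curve y_2 is the determinant of velocity and acceleration over the cube of
    the x-velocity, whence one factor det A and the exponent 3. *)
Lemma img_jet_y2 (R : realType) (A : 'M[R]_2) (u v : {poly R}) (t : R) :
  (imgX A u)^`().[t] != 0 ->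
  img_jet A u v t 5 = det2 A * u^`()^`().[t] / (imgX A u)^`().[t] ^+ 3.
Proof.
have -> : img_jet A u v t 5
  = (((imgY A u)^`() * (imgX A u)^`())^`() * (imgX A u)^`()
    - (imgY A u)^`() * (imgX A u)^`() * (imgX A u)^`()^`() *+ 2).[t]
    / (imgX A u)^`().[t] ^+ 4 by rewrite /= mulr0n subr0.
rewrite !(hornerD, hornerN, hornerMn, hornerM) imgX_deriv => X'0.
rewrite /imgY /imgX /det2 !(derivD, derivM, derivZ, derivX, derivC).
rewrite !(hornerD, hornerN, hornerMn, hornerM, hornerZ, hornerX, hornerC).
by field.
Qed.

Lemma I1_represented (R : realType) :
  represented (I1 R) (fun u v => v^`() - u) (@delta R).
Proof.
have n0 : ('X_(ix 1) * 'X_(iy 1 1) - 'X_(iy 1 0) : jetpoly R 1) != 0.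
  (* On the curve y = -1 this denominator equals 1. *)
  apply/eqP => e0; have := congr1 (fun P => (along P (-1) 0).[0]) e0.
  rewrite along0 alongB alongM !along_var !inordK //= horner0 hornerD hornerM.
  by rewrite hornerX mul0r add0r opprK hornerC => /eqP; rewrite oner_eq0.
exists ('X_(iz 1 1) - 'X_(iy 1 0)), ('X_(ix 1) * 'X_(iy 1 1) - 'X_(iy 1 0)).
split=> //; first by rewrite /I1 /jx /jy /jz -tofracM -!tofracB.
  by move=> u v; rewrite alongB !along_var !inordK.
by move=> u v; rewrite alongB alongM !along_var !inordK.
Qed.

Lemma delta_represented (R : realType) (k : nat) : (0 < k)%N ->
  exists2 P : jetpoly R k, P != 0 & forall u v, along P u v = delta u v.
Proof.
move=> k0; exists ('X_(ix k) * 'X_(iy k 1) - 'X_(iy k 0)) => [|u v]; last first.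
  by rewrite alongB alongM !along_var !inordK // /ncoord; lia.
apply/eqP => e0; have := congr1 (fun P => (along P (-1) 0).[0]) e0.
rewrite along0 alongB alongM !along_var !inordK /ncoord; try lia.
rewrite /= horner0 hornerD hornerM hornerX mul0r add0r opprK hornerC => /eqP.
by rewrite oner_eq0.
Qed.

Lemma delta_neq0 (R : realType) : exists u v : {poly R}, delta u v != 0.
Proof.
have [P P0 PE] := delta_represented R (ltn0Sn 0).
by have [u [v uv]] := along_neq0 P0; exists u, v; rewrite -PE.
Qed.

Lemma I2a'_represented (R : realType) :
  represented (I2a' R) (fun u v => area u v ^+ 2 * u^`()^`())
    (fun u v => delta u v ^+ 3).
Proof.
exists (('X_(iz 2 0) *+ 2 - 'X_(ix 2) * 'X_(iy 2 0)) ^+ 2 * 'X_(iy 2 2)).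
exists (('X_(ix 2) * 'X_(iy 2 1) - 'X_(iy 2 0)) ^+ 3); split.
- have [P P0 PE] := @delta_represented R 2 isT; rewrite expf_neq0 //.
  apply: contraNneq P0 => e; apply/eqP; rewrite -e; apply: along_inj => u v.
  by rewrite PE alongB alongM !along_var !inordK.
- rewrite /I2a' /jx /jy /jz tofracM !tofracXn !tofracB tofracMn !tofracM.
  by rewrite mulr_natl mulrAC.
- move=> u v; rewrite alongM alongX alongB alongM !along_var !inordK //.
  by rewrite /along mmapMn -/(along _ _ _) along_var inordK.
- by move=> u v; rewrite alongX alongB alongM !along_var !inordK.
Qed.

Lemma nabla'_represented (R : realType) :
  represented (nabla'_coef R) (@area R) (@delta R).
Proof.
exists ('X_(iz 1 0) *+ 2 - 'X_(ix 1) * 'X_(iy 1 0)).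
exists ('X_(ix 1) * 'X_(iy 1 1) - 'X_(iy 1 0)); split.
- have [P P0 PE] := @delta_represented R 1 isT.
  apply: contraNneq P0 => e; apply/eqP; rewrite -e; apply: along_inj => u v.
  by rewrite PE alongB alongM !along_var !inordK.
- rewrite /nabla'_coef /jx /jy /jz !tofracB tofracMn !tofracM.
  by rewrite mulr_natl.
- move=> u v; rewrite alongB alongM !along_var !inordK //.
  by rewrite /along mmapMn -/(along _ _ _) along_var inordK.
- by move=> u v; rewrite alongB alongM !along_var !inordK.
Qed.

Lemma img_realised (R : realType) (A : 'M[R]_2) (u v : {poly R}) (t : R) (n : nat) :
  exists U V s, forall i, (i < n)%N -> (jet_coord U V i).[s] = img_jet A u v t i.
Proof.
have [U [V UV]] := jet_realised n (img_jet A u v t).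
by exists U, V, (img_jet A u v t 0).
Qed.

(** The image jet is realised by a polynomial curve [(U, V)], so that the comparison takes place
    between two curves; [n] is the number of image coordinates it may use. *)
Lemma represented_pullback (R : realType) (A : 'M[R]_2) (k n : nat)
    (f g : jetrat R k) F1 G1 F2 G2 (H : {poly R} -> {poly R} -> {poly R}) :
  A \in unitmx -> represented f F1 G1 -> represented g F2 G2 ->
  jet_poly H -> (exists u v, H u v != 0) ->
  (forall u v t U V s, (imgX A u)^`().[t] != 0 -> (H u v).[t] != 0 ->
    (forall i, (i < n)%N -> (jet_coord U V i).[s] = img_jet A u v t i) ->
    (F1 U V).[s] * (G2 u v).[t] = (F2 u v).[t] * (G1 U V).[s]) ->
  is_pullback A f g.
Proof.
move=> uA [P1 [Q1 [Q10 fE PF1 QG1]]] [P2 [Q2 [Q20 gE PF2 QG2]]] jH H0 generic.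
apply: (is_pullback_criterion uA Q10 Q20 fE gE jH H0) => u v t X'0 Ht.
have [U [V [s UV]]] := img_realised A u v t (maxn n (ncoord k)).
have UVn i : (i < n)%N -> (jet_coord U V i).[s] = img_jet A u v t i.
  by move=> lin; apply: UV; rewrite leq_max lin.
have PE (P : jetpoly R k) : P.@[fun i => img_jet A u v t i] = (along P U V).[s].
  by rewrite horner_along; apply: meval_eq => i; rewrite UV // leq_max ltn_ord orbT.
by rewrite !PE PF1 QG1 PF2 QG2; apply: generic Ht UVn.
Qed.

Lemma jet_poly1_neq0 (R : realType) :
  exists u v : {poly R}, (fun _ _ : {poly R} => 1%:P : {poly R}) u v != 0.
Proof. by exists 0, 0; rewrite oner_neq0. Qed.

Lemma img_curve (R : realType) (A : 'M[R]_2) (u v : {poly R}) (t : R)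
    (U V : {poly R}) (s : R) :
  (imgX A u)^`().[t] != 0 ->
  (forall i, (i < 6)%N -> (jet_coord U V i).[s] = img_jet A u v t i) ->
  [/\ (delta U V).[s] = det2 A * (delta u v).[t] / (imgX A u)^`().[t],
      (V^`() - U).[s] = det2 A * (v^`() - u).[t] / (imgX A u)^`().[t],
      (area U V).[s] = det2 A * (area u v).[t] &
      U^`()^`().[s] = det2 A * u^`()^`().[t] / (imgX A u)^`().[t] ^+ 3].
Proof.
move=> X'0 UV; split.
- by rewrite -img_jet_delta // -!UV // /delta hornerD hornerN hornerM.
- by rewrite -img_jet_slope // -!UV // hornerD hornerN.
- by rewrite -img_jet_area -!UV // /area hornerD hornerN hornerMn hornerM.
- by rewrite -(img_jet_y2 v) // -UV.
Qed.

Lemma I1_invariant (R : realType) : diff_invariant (I1 R).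
Proof.
move=> A uA; apply: (represented_pullback uA (I1_represented R)
  (I1_represented R) (jet_poly_const 1) (jet_poly1_neq0 R)).
move=> u v t U V s X'0 _ /(img_curve X'0)[-> -> _ _]; ring.
Qed.

(** Numerator and denominator both acquire the factor (det A / X')^3. *)
Lemma I2a'_invariant (R : realType) : diff_invariant (I2a' R).
Proof.
move=> A uA; apply: (represented_pullback uA (I2a'_represented R)
  (I2a'_represented R) (jet_poly_const 1) (jet_poly1_neq0 R)).
move=> u v t U V s X'0 _ /(img_curve X'0)[D _ E Y2].
by rewrite !hornerM D E Y2; field.
Qed.

Lemma deriv_along (R : realType) (n : nat) (P : {mpoly R[n]}) (u v : {poly R}) (t : R)
    (w : nat -> R) : (forall i, (i < n.+2)%N -> (jet_coord u v i).[t] = w i) ->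
  (along P u v)^`().[t] = total_deriv P w.
Proof.
move=> uvw; rewrite deriv_mmap horner_sum; apply: eq_bigr => i _.
rewrite hornerM horner_mmap jet_coord_deriv; congr (_ * _); last first.
  by apply: meval_eq => j; rewrite uvw // ltnW // ltnW // !ltnS.
by case ij : (nat_of_ord i) => [|j]; rewrite ?hornerC // uvw // -ij !ltnS.
Qed.

(** Pointwise equality becomes an identity free of denominators, valid wherever X' is nonzero and
    hence fit for differentiation. *)
Lemma pullback_identity (R : realType) (A : 'M[R]_2) (k : nat) (f g : jetrat R k) :
  A \in unitmx -> is_pullback A f g ->
  forall u v t, (imgX A u)^`().[t] != 0 ->
    (\n_(repr f)).@[fun i => img_jet A u v t i] * (along (\d_(repr g)) u v).[t]
    = (along (\n_(repr g)) u v).[t] * (\d_(repr f)).@[fun i => img_jet A u v t i].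
Proof.
move=> uA pull; have df : \d_(repr f) != 0 by apply: denom_ratioP.
have dg : \d_(repr g) != 0 by apply: denom_ratioP.
apply: (img_identity uA df (jet_poly_along _) (along_neq0 dg)).
move=> u v t X'0 dfq dgp; apply/eqP; rewrite -eqr_div //; apply/eqP.
pose p : jet R k := fun i => (jet_coord u v i).[t].
pose q : jet R k := fun i => img_jet A u v t i.
have pq : prolong A p q by apply/prolongP; exists u, v, t.
rewrite !horner_along in dgp *; apply: (pull p q pq).
  by exists (\n_(repr f)), (\d_(repr f)); split=> //; apply: frac_repr.
by exists (\n_(repr g)), (\d_(repr g)); split=> //; apply: frac_repr.
Qed.

(* The identity [n1(q) d2(p) = n2(p) d1(q)], with [q] the image of [p],
   differentiated along a curve. *)
Lemma img_identity_deriv (R : realType) (A : 'M[R]_2) (n m : nat)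
    (n1 d1 : {mpoly R[n]}) (n2 d2 : {mpoly R[m]}) :
  (forall u v t, (imgX A u)^`().[t] != 0 ->
    n1.@[fun i => img_jet A u v t i] * (along d2 u v).[t]
    = (along n2 u v).[t] * d1.@[fun i => img_jet A u v t i]) ->
  forall u v t, (imgX A u)^`().[t] != 0 ->
    (imgX A u)^`().[t] * total_deriv n1 (img_jet A u v t) * (along d2 u v).[t]
      + n1.@[fun i => img_jet A u v t i] * (along d2 u v)^`().[t]
    = (along n2 u v)^`().[t] * d1.@[fun i => img_jet A u v t i]
      + (imgX A u)^`().[t] * (along n2 u v).[t] * total_deriv d1 (img_jet A u v t).
Proof.
move=> eqn u v t X'0.
have [N1 [F1 [_ /(_ u v) F1E]]] := img_poly A n1.
have [N2 [F2 [_ /(_ u v) F2E]]] := img_poly A d1.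
set a := (imgX A u)^`() in X'0 F1E F2E *.
(* Powers of X' turn both sides into polynomials of the same weight [N1 + N2], to which
   [weighted_deriv] is then applied. An extra factor [a] makes the zeros of X' harmless. *)
have E : F1 u v * (along d2 u v * a ^+ N2) = F2 u v * (along n2 u v * a ^+ N1).
  have a0 : a != 0 by apply: contraNneq X'0 => ->; rewrite horner0.
  apply: (mulfI a0); apply/eqP; rewrite -subr_eq0; apply/eqP/poly_fun_eq0 => s.
  rewrite !(hornerD, hornerN, hornerM, horner_exp).
  have [->|as0] := eqVneq a.[s] 0; first by rewrite !mul0r subr0.
  have [-> _] := F1E s as0; have [-> _] := F2E s as0.
  set x := n1.@[_]; set y := d1.@[_].
  transitivity (a.[s] * a.[s] ^+ N1 * a.[s] ^+ N2 *
    (x * (along d2 u v).[s] - (along n2 u v).[s] * y)); first by ring.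
  by rewrite (eqn u v s as0) subrr mulr0.
have [F1t dF1t] := F1E t X'0; have [F2t dF2t] := F2E t X'0.
have wE b N : weighted_deriv a N (b * a ^+ N) = b^`() * a * a ^+ N.
  have -> : N = (0 + N)%N by [].
  by rewrite weighted_derivM weighted_deriv_exp mulr0 addr0 /weighted_deriv mulr0n subr0.
have := congr1 (fun P => (weighted_deriv a (N1 + N2) P).[t]) E.
rewrite /= weighted_derivM [in RHS]addnC weighted_derivM !wE.
rewrite hornerD [RHS]hornerD !hornerM dF1t dF2t F1t F2t !horner_exp.
set x := n1.@[_]; set y := d1.@[_].
move=> e; apply: (mulfI (expf_neq0 (N1 + N2).+1 X'0)).
move: e; rewrite !exprS exprD => e.
transitivity (a.[t] * (a.[t] * a.[t] ^+ N1) * total_deriv n1 (img_jet A u v t) *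
     ((along d2 u v).[t] * a.[t] ^+ N2) +
     a.[t] ^+ N1 * x * ((along d2 u v)^`().[t] * a.[t] * a.[t] ^+ N2)); first by ring.
by rewrite !mulrA in e *; rewrite e; ring.
Qed.

(** Along the image curve D_x is (1/X') d/dt, and the coefficient h/d acquires the compensating
    factor X'. *)
Lemma nabla'_invariant (R : realType) : invariant_derivation (nabla'_coef R).
Proof.
move=> A uA k f g k1 pull.
apply: (represented_pullback (n := maxn 6 (ncoord k).+2) uA
  (represented_derivation k1 (nabla'_represented R) (represented_repr f))
  (represented_derivation k1 (nabla'_represented R) (represented_repr g))
  (jet_poly_const 1) (jet_poly1_neq0 R)).
move=> u v t U V s X'0 _ UV.
have e1 := pullback_identity uA pull v X'0.
have e2 := img_identity_deriv (pullback_identity uA pull) v X'0.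
have [D _ E _] := @img_curve R A u v t U V s X'0
  (fun i i6 => UV i (leq_trans i6 (leq_maxl _ _))).
have UVk i : (i < (ncoord k).+2)%N -> (jet_coord U V i).[s] = img_jet A u v t i.
  by move=> ik; apply: UV; rewrite leq_max ik orbT.
have dE (P : jetpoly R k) : (along P U V)^`().[s] = total_deriv P (img_jet A u v t).
  exact: deriv_along UVk.
have vE (P : jetpoly R k) : (along P U V).[s] = P.@[fun i => img_jet A u v t i].
  by rewrite horner_along; apply: meval_eq => i; exact: UVk (leqW (leqW (ltn_ord i))).
rewrite !hornerM D E.
move: (det2 A) (area u v).[t] (delta u v).[t] => c h dl.
rewrite !(hornerM, hornerD, hornerN) !dE !vE.
move: e1 e2; set a := (imgX A u)^`().[t] in X'0 *.
move: (meval _ _) (meval _ _) (total_deriv _ _) (total_deriv _ _) => y x y' x'.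
move: (along _ u v) (along _ u v) => n d.
move: d.[t] n.[t] d^`().[t] n^`().[t] => d2 n2 d2' n2' e1 e2.
(* The numerators of the two quotient rules correspond: [e2] is the derivative of the identity [e1],
   which removes the remaining terms. *)
have key : a * (x' * y - x * y') * d2 ^+ 2 = (n2' * d2 - n2 * d2') * y ^+ 2.
  have e3 : a * x' * d2 = n2' * y + a * n2 * y' - x * d2' by rewrite -e2; ring.
  transitivity (y * d2 * (a * x' * d2) - a * y' * d2 * (x * d2)); first by ring.
  rewrite e3; transitivity (y * d2 * (n2' * y + a * n2 * y') - y * d2' * (x * d2)
    - a * y' * d2 * (x * d2)); first by ring.
  by rewrite e1; ring.
apply: (mulfI X'0).
transitivity (c * h * dl * (a * (x' * y - x * y') * d2 ^+ 2)); first by ring.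
by rewrite key; field.
Qed.

(** * The generators in coordinates *)

Lemma represented_eq (R : realType) (k : nat) (f g : jetrat R k) F1 G1 F2 G2 :
  represented f F1 G1 -> represented g F2 G2 ->
  f = g <-> forall u v, F1 u v * G2 u v = F2 u v * G1 u v.
Proof.
move=> [P1 [Q1 [Q10 -> PF1 QG1]]] [P2 [Q2 [Q20 -> PF2 QG2]]].
rewrite divF_eq //; split=> [PQ u v|FG].
  by rewrite -PF1 -PF2 -QG1 -QG2 -!alongM PQ.
by apply: along_inj => u v; rewrite !alongM PF1 PF2 QG1 QG2.
Qed.

Lemma represented_jet_poly (R : realType) (k : nat) (f : jetrat R k) F G :
  represented f F G ->
  [/\ jet_poly F, jet_poly G & exists u v, G u v != 0].
Proof.
move=> [P [Q [Q0 _ PF QG]]]; split.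
- by exists (ncoord k), P.
- by exists (ncoord k), Q.
- by have [u [v uv]] := along_neq0 Q0; exists u, v; rewrite -QG.
Qed.

Lemma jet_poly_generic_eq0 (R : realType) (F H : {poly R} -> {poly R} -> {poly R}) :
  jet_poly F -> jet_poly H -> (exists u v, H u v != 0) ->
  (forall u v t, (H u v).[t] != 0 -> (F u v).[t] = 0) -> forall u v, F u v = 0.
Proof.
move=> jF jH H0 FH u v; apply/eqP/negPn/negP => Fuv.
have F0 : exists u v, F u v != 0 by exists u, v.
have [w [z wz]] := jet_poly_mulf_neq0 jF jH F0 H0.
have [t] := poly_neq0_fun wz; rewrite hornerM mulf_eq0 negb_or => /andP[Ft /FH].
by move/eqP: Ft.
Qed.

Lemma represented_const (R : realType) (k : nat) (c : R) :
  represented ((c%:MP : jetpoly R k)%:F) (fun _ _ => c%:P) (fun _ _ => 1).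
Proof.
exists c%:MP, 1; split; rewrite ?oner_neq0 ?tofrac1 ?divr1 //= => u v.
  exact: alongC.
exact: rmorph1.
Qed.

Lemma represented_add (R : realType) (k : nat) (f g : jetrat R k) F1 G1 F2 G2 :
  represented f F1 G1 -> represented g F2 G2 ->
  represented (f + g) (fun u v => F1 u v * G2 u v + F2 u v * G1 u v)
    (fun u v => G1 u v * G2 u v).
Proof.
move=> [P1 [Q1 [Q10 -> PF1 QG1]]] [P2 [Q2 [Q20 -> PF2 QG2]]].
exists (P1 * Q2 + P2 * Q1), (Q1 * Q2); split.
- exact: mulf_neq0.
- by rewrite addf_div ?tofrac_eq0 // -!tofracM -tofracD.
- by move=> u v; rewrite alongD !alongM PF1 PF2 QG1 QG2.
- by move=> u v; rewrite alongM QG1 QG2.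
Qed.

Lemma represented_mul (R : realType) (k : nat) (f g : jetrat R k) F1 G1 F2 G2 :
  represented f F1 G1 -> represented g F2 G2 ->
  represented (f * g) (fun u v => F1 u v * F2 u v) (fun u v => G1 u v * G2 u v).
Proof.
move=> [P1 [Q1 [Q10 -> PF1 QG1]]] [P2 [Q2 [Q20 -> PF2 QG2]]].
exists (P1 * P2), (Q1 * Q2); split.
- exact: mulf_neq0.
- by rewrite mulf_div -!tofracM.
- by move=> u v; rewrite alongM PF1 PF2.
- by move=> u v; rewrite alongM QG1 QG2.
Qed.

Lemma represented_inv (R : realType) (k : nat) (f : jetrat R k) F G :
  f != 0 -> represented f F G -> represented f^-1 G F.
Proof.
move=> f0 [P [Q [Q0 fE PF QG]]]; exists Q, P; split=> //; last by rewrite fE invf_div.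
by apply: contraNneq f0 => P0; rewrite fE P0 tofrac0 mul0r.
Qed.

(** The quotient rule without cancellation; starting from powers of [delta], the denominators remain
    powers of [delta]. *)
Definition nabla'_pair (R : realType)
    (FG : ({poly R} -> {poly R} -> {poly R}) * ({poly R} -> {poly R} -> {poly R})) :=
  (fun u v => area u v * ((FG.1 u v)^`() * FG.2 u v - FG.1 u v * (FG.2 u v)^`()),
   fun u v => delta u v * FG.2 u v ^+ 2).

(* Numerator and denominator of [nabla'^j I1] (for [b = false]) and of
   [nabla'^j I2a'] (for [b = true]). *)
Definition gen_pair (R : realType) (b : bool) (j : nat) :=
  iter j (@nabla'_pair R)
    (if b then (fun u v => area u v ^+ 2 * u^`()^`(), fun u v => delta u v ^+ 3)
     else (fun u v => v^`() - u, @delta R)).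

Definition gen_value (R : realType) (b : bool) (j : nat) (u v : {poly R}) (t : R) : R :=
  ((gen_pair R b j).1 u v).[t] / ((gen_pair R b j).2 u v).[t].

Lemma I1_iter_represented (R : realType) (j : nat) :
  represented (derivation_iter (nabla'_coef R) (I1 R) j)
    (gen_pair R false j).1 (gen_pair R false j).2.
Proof.
elim: j => [|j IHj]; first exact: I1_represented.
exact: represented_derivation (nabla'_represented R) IHj.
Qed.

Lemma I2a'_iter_represented (R : realType) (j : nat) :
  represented (derivation_iter (nabla'_coef R) (I2a' R) j)
    (gen_pair R true j).1 (gen_pair R true j).2.
Proof.
elim: j => [|j IHj]; first exact: I2a'_represented.
exact: represented_derivation (nabla'_represented R) IHj.
Qed.

Lemma derivation_iter_invariant (R : realType) (k j : nat) (f : jetrat R k) :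
  diff_invariant f -> diff_invariant (derivation_iter (nabla'_coef R) f j).
Proof.
move=> inv; elim: j => [//|j IHj] A uA.
by apply: nabla'_invariant => //; apply: IHj.
Qed.

Lemma jet_fun_delta (R : realType) : jet_fun 4 (@delta R).
Proof.
apply: jet_funD; last by apply: jet_funN; apply: (jet_fun_coord _ (isT : 1 < 4)%N).
apply: jet_funM; first exact: (jet_fun_coord _ (isT : 0 < 4)%N).
exact: (jet_fun_coord _ (isT : 3 < 4)%N).
Qed.

Lemma jet_fun_area (R : realType) : jet_fun 4 (@area R).
Proof.
apply: jet_funD; first by apply: jet_funMn; apply: (jet_fun_coord _ (isT : 2 < 4)%N).
apply: jet_funN; apply: jet_funM; first exact: (jet_fun_coord _ (isT : 0 < 4)%N).
exact: (jet_fun_coord _ (isT : 1 < 4)%N).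
Qed.

(* The highest coordinate on which the generator depends. *)
Definition gen_index (b : bool) (j : nat) : nat := (b + j.*2).+4.

(** Differentiation moves the top coordinate up by two numbers and multiplies its coefficient by
    [area] times the denominator. The coefficient and the denominator involve only x, y, z, y_1 and
    are thus constant on the cross-section. *)
Lemma gen_pair_triangular (R : realType) (b : bool) (j : nat) :
  exists C S : {poly R} -> {poly R} -> {poly R},
  [/\ forall u v, (gen_pair R b j).1 u v = C u v * jet_coord u v (gen_index b j) + S u v,
    jet_fun 4 C, jet_fun (gen_index b j) S, jet_fun 4 (gen_pair R b j).2 &
    forall u v t, (delta u v).[t] != 0 -> ((gen_pair R b j).2 u v).[t] != 0 /\
      ((area u v).[t] != 0 -> (C u v).[t] != 0)].
Proof.
elim: j => [|j [C [S [E jC jS jG nz]]]].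
  case: b.
    exists (fun u v => area u v ^+ 2), (fun _ _ => 0); split.
    - by move=> u v; rewrite addr0.
    - by apply: jet_funX; apply: jet_fun_area.
    - by exists 0 => u v; rewrite along0.
    - by apply: jet_funX; apply: jet_fun_delta.
    - by move=> u v t d0; split=> [|a0] /=; rewrite horner_exp expf_neq0.
  exists (fun _ _ => 1), (fun u _ => - u); split.
  - by move=> u v; rewrite mul1r.
  - exact: (jet_fun_const _ 1).
  - by apply: jet_funN; apply: (jet_fun_coord _ (isT : 1 < 4)%N).
  - exact: jet_fun_delta.
  - by move=> u v t d0; split=> [|_] //=; rewrite hornerC oner_neq0.
set i := gen_index b j in E jS; have i4 : (4 <= i)%N by [].
have -> : gen_index b j.+1 = i.+2 by rewrite /i /gen_index; lia.
have wide (F : {poly R} -> {poly R} -> {poly R}) : jet_fun 4 F -> jet_fun i.+2 F.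
  by apply: jet_fun_widen; lia.
have wide' (F : {poly R} -> {poly R} -> {poly R}) :
    jet_fun 4 F -> jet_fun i.+2 (fun u v => (F u v)^`()).
  by move=> jF; apply: (@jet_fun_widen _ 6); [lia|apply: jet_fun_deriv].
pose w (u v : {poly R}) := jet_coord u v i.
have jw : jet_fun i.+2 w by apply: jet_fun_coord.
(* Coordinate [i.+2] arises only by differentiating [w]: derivatives of [C] and of the denominator
   stay below 6, which is at most [i.+2], and the derivative of [S] stays below [i.+2]. *)
exists (fun u v => area u v * C u v * (gen_pair R b j).2 u v).
exists (fun u v => area u v * (((C u v)^`() * w u v + (S u v)^`()) * (gen_pair R b j).2 u v
  - (C u v * w u v + S u v) * ((gen_pair R b j).2 u v)^`())); split.
- move=> u v; rewrite [LHS]/= -/(gen_pair R b j) E derivD derivM jet_coord_deriv -/(w u v).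
  by rewrite {2}/i /=; ring.
- by apply: jet_funM => //; apply: jet_funM => //; apply: jet_fun_area.
- apply: jet_funM; first by apply: wide; apply: jet_fun_area.
  have jS2 : jet_fun i.+2 S by apply: jet_fun_widen jS; lia.
  apply: jet_funD; [|apply: jet_funN]; apply: jet_funM; rewrite -?/(jet_fun _ _).
  + apply: jet_funD; last exact: jet_fun_deriv.
    by apply: jet_funM => //; apply: wide'.
  + exact: wide.
  + by apply: jet_funD => //; apply: jet_funM => //; apply: wide.
  + exact: wide'.
- by apply: jet_funM; [apply: jet_fun_delta|apply: jet_funX].
- move=> u v t d0; have [G0 C0] := nz u v t d0; split=> [|a0].
    by rewrite [X in X.[t]]/= -/(gen_pair R b j) hornerM horner_exp mulf_neq0 ?expf_neq0.
  by rewrite !hornerM !mulf_neq0 ?C0.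
Qed.

Definition gen_vector (R : realType) (m : nat) (u v : {poly R}) (t : R)
    (i : 'I_(m + m)) : R :=
  match split i with
  | inl j => gen_value false j u v t
  | inr j => gen_value true j u v t
  end.

Lemma split_lshift_eq (m n : nat) (j : 'I_m) : split (lshift n j) = inl j.
Proof. exact: (unsplitK (inl j)). Qed.

Lemma split_rshift_eq (m n : nat) (j : 'I_n) : split (rshift m j) = inr j.
Proof. exact: (unsplitK (inr j)). Qed.

Definition gen_ord (b : bool) (m : nat) (j : 'I_m) : 'I_(m + m) :=
  if b then rshift m j else lshift m j.

Lemma gen_vector_ord (R : realType) (b : bool) (m : nat) (j : 'I_m) (u v : {poly R})
    (t : R) : gen_vector u v t (gen_ord b j) = gen_value b j u v t.
Proof.
by case: b; rewrite /gen_vector /gen_ord ?split_lshift_eq ?split_rshift_eq.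
Qed.

Lemma generators_represented (R : realType) (m : nat) (i : 'I_(m + m)) :
  exists b (j : 'I_m), i = gen_ord b j /\
  represented (generators R i) (gen_pair R b j).1 (gen_pair R b j).2.
Proof.
rewrite /generators; case: split_ordP => j ->.
  exists false, j; split=> //; apply: represented_lift.
    by have := ltn_ord j; lia.
  exact: I1_iter_represented.
exists true, j; split=> //; apply: represented_lift.
  by have := ltn_ord j; lia.
exact: I2a'_iter_represented.
Qed.

Lemma gen_den_neq0 (R : realType) (b : bool) (j : nat) (u v : {poly R}) (t : R) :
  (delta u v).[t] != 0 -> ((gen_pair R b j).2 u v).[t] != 0.
Proof.
by move=> d0; have [C [S [_ _ _ _ nz]]] := gen_pair_triangular R b j;
  have [] := nz u v t d0.
Qed.

(** All denominators are products of powers of [delta], so wherever [delta] is nonzero the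
    substitution can be evaluated through the values of the generators. *)
Lemma subst_generators_value (R : realType) (m : nat) (P : {mpoly R[m + m]}) :
  exists F G, represented (subst_generators P) F G /\
  forall u v t, (delta u v).[t] != 0 ->
    (G u v).[t] != 0 /\ (F u v).[t] = (G u v).[t] * P.@[gen_vector u v t].
Proof.
pose h : {rmorphism R -> jetrat R m.+1} :=
  @FracField.tofrac _ \o @mpolyC (ncoord m.+1) R.
have sE Q : subst_generators Q = mmap h (@generators R m) Q by [].
rewrite sE; elim/mpoly_ring_ind: P => [c|i|P Q [F1 [G1 [r1 E1]]] [F2 [G2 [r2 E2]]]|
    P Q [F1 [G1 [r1 E1]]] [F2 [G2 [r2 E2]]]].
- exists (fun _ _ => c%:P), (fun _ _ => 1); rewrite mmapC; split.
    exact: represented_const.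
  by move=> u v t _; rewrite !hornerC mevalC mul1r oner_neq0.
- rewrite mmapX mmap1U; have [b [j [-> rep]]] := generators_represented R i.
  exists (gen_pair R b j).1, (gen_pair R b j).2; split=> // u v t d0.
  have G0 := gen_den_neq0 b j d0; split=> //.
  by rewrite mevalXU gen_vector_ord /gen_value mulrC divfK.
- exists (fun u v => F1 u v * G2 u v + F2 u v * G1 u v), (fun u v => G1 u v * G2 u v).
  rewrite mmapD; split=> [|u v t d0]; first exact: represented_add.
  have [G10 F1E] := E1 u v t d0; have [G20 F2E] := E2 u v t d0.
  rewrite hornerD !hornerM mulf_neq0 // mevalD F1E F2E; split=> //; ring.
- exists (fun u v => F1 u v * F2 u v), (fun u v => G1 u v * G2 u v).
  rewrite rmorphM; split=> [|u v t d0]; first exact: represented_mul.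
  have [G10 F1E] := E1 u v t d0; have [G20 F2E] := E2 u v t d0.
  rewrite !hornerM mulf_neq0 // mevalM F1E F2E; split=> //; ring.
Qed.

Lemma jet_fun_value (R : realType) (n : nat) (F : {poly R} -> {poly R} -> {poly R})
    (u v u' v' : {poly R}) (t t' : R) :
  jet_fun n F ->
  (forall i, (i < n)%N -> (jet_coord u v i).[t] = (jet_coord u' v' i).[t']) ->
  (F u v).[t] = (F u' v').[t'].
Proof.
move=> [P PF] uv; rewrite !PF !horner_along.
by apply: meval_eq => i; apply: uv.
Qed.

(** The bound [(gen_index b j).+2] covers every coordinate of the jet space carrying the generator,
    including a possible z of top order on which it does not depend. *)
Lemma gen_value_invariant (R : realType) (A : 'M[R]_2) (b : bool) (j : nat)
    (u v : {poly R}) (t : R) (U V : {poly R}) (s : R) :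
  A \in unitmx -> (imgX A u)^`().[t] != 0 -> (delta u v).[t] != 0 ->
  (forall i, (i < (gen_index b j).+2)%N -> (jet_coord U V i).[s] = img_jet A u v t i) ->
  gen_value b j U V s = gen_value b j u v t.
Proof.
move=> uA X'0 d0 UV.
have D0 : (delta U V).[s] != 0.
  have [|-> _ _ _] := @img_curve R A u v t U V s X'0.
    by move=> i i6; apply: UV; apply: leq_trans i6 _; rewrite /gen_index; lia.
  by rewrite !mulf_neq0 ?invr_eq0 // -det2_neq0.
have inv k (f : jetrat R k) : (ncoord k <= (gen_index b j).+2)%N -> diff_invariant f ->
    represented f (gen_pair R b j).1 (gen_pair R b j).2 ->
    gen_value b j U V s = gen_value b j u v t.
  move=> kj finv [P [Q [Q0 fE PF QG]]].
  pose p : jet R k := fun i => (jet_coord u v i).[t].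
  pose q : jet R k := fun i => (jet_coord U V i).[s].
  have pq : prolong A p q.
    apply/prolongP; exists u, v, t; split=> // i.
    by apply: UV; apply: leq_trans (ltn_ord i) kj.
  apply: (finv A uA p q pq).
    exists P, Q; rewrite /gen_value -PF -QG !horner_along; split=> //.
    by rewrite -horner_along QG gen_den_neq0.
  exists P, Q; rewrite /gen_value -PF -QG !horner_along; split=> //.
  by rewrite -horner_along QG gen_den_neq0.
case: b UV inv => UV inv.
  apply: inv (I2a'_iter_represented R j); first by rewrite /ncoord /gen_index; lia.
  exact/derivation_iter_invariant/I2a'_invariant.
apply: inv (I1_iter_represented R j); first by rewrite /ncoord /gen_index; lia.
exact/derivation_iter_invariant/I1_invariant.
Qed.

(** The triangular system is solved one coordinate at a time, over a base point with d = h = 1. *)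
Lemma gen_value_onto (R : realType) (g : bool -> nat -> R) (n : nat) :
  exists w : nat -> R, [/\ w 0%N = 1, w 1%N = 0, w 2 = 2^-1, w 3 = 1 &
  forall u v t, (forall i, (i < n)%N -> (jet_coord u v i).[t] = w i) ->
  forall b j, (gen_index b j < n)%N -> gen_value b j u v t = g b j].
Proof.
elim: n => [|n [w [w0 w1 w2 w3 wg]]].
  exists (fun i => if i is 0 then 1 else if i is 1 then 0 else if i is 2 then 2^-1 else 1).
  by split.
have [n4|n4] := ltnP n 4.
  exists w; split=> // u v t uvw b j; rewrite /gen_index; lia.
(* Each coordinate from number 4 on is the top one of exactly one generator: odd numbers belong to
   [I2a'], even ones to [I1]. *)
have [b0 [j0 nE]] : exists b0 j0, n = gen_index b0 j0.
  by exists (odd n), (n - 4)./2; rewrite /gen_index; lia.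
have [C [S [E jC jS jG nz]]] := gen_pair_triangular R b0 j0.
have [u0 [v0 uvw0]] := jet_realised n w.
pose t0 := w 0%N.
have [da aa] : (delta u0 v0).[t0] = 1 /\ (area u0 v0).[t0] = 1.
  have x0 := uvw0 0%N (leq_trans (isT : 0 < 4)%N n4).
  have y0 := uvw0 1%N (leq_trans (isT : 1 < 4)%N n4).
  have z0 := uvw0 2 (leq_trans (isT : 2 < 4)%N n4).
  have y1 := uvw0 3 (leq_trans (isT : 3 < 4)%N n4).
  rewrite /= in x0 y0 z0 y1; rewrite /delta /area.
  rewrite !hornerD !hornerN !hornerM x0 y0 z0 y1 w0 w1 w2 w3.
  by split; field.
have [G0] : ((gen_pair R b0 j0).2 u0 v0).[t0] != 0 /\
    ((area u0 v0).[t0] != 0 -> (C u0 v0).[t0] != 0).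
  by apply: nz; rewrite da oner_neq0.
rewrite aa oner_neq0 => /(_ isT) C0.
(* The new coordinate solves the affine equation that prescribes the generator. *)
pose w' i := if i == n then
  (((gen_pair R b0 j0).2 u0 v0).[t0] * g b0 j0 - (S u0 v0).[t0]) / (C u0 v0).[t0]
  else w i.
have ww' i : (i < n)%N -> w' i = w i by rewrite /w'; case: eqP => // ->; rewrite ltnn.
exists w'; split; rewrite ?ww' //; try by apply: leq_trans n4.
move=> u v t uvw b j; rewrite ltnS leq_eqVlt => /orP[/eqP jn|jn]; last first.
  by apply: wg jn => i lin; rewrite uvw ?ww' // ltnW.
have [-> ->] : b = b0 /\ j = j0.
  by move: jn; rewrite nE /gen_index; case: (b); case: (b0) => /=; split; lia.
have uv0 i : (i < n)%N -> (jet_coord u v i).[t] = (jet_coord u0 v0 i).[t0].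
  by move=> lin; rewrite uvw0 // uvw ?ww' // ltnW.
have uv4 i : (i < 4)%N -> (jet_coord u v i).[t] = (jet_coord u0 v0 i).[t0].
  by move=> i4; apply: uv0; apply: leq_trans i4 n4.
rewrite /gen_value E hornerD hornerM -nE uvw // (jet_fun_value jC uv4).
rewrite (jet_fun_value jG uv4) -nE in jS *.
rewrite (jet_fun_value jS uv0) /w' eqxx; field.
by rewrite G0 C0.
Qed.

(** Any vector [g] is attained by the generators at some jet, so [P] vanishes as a function. *)
Lemma generators_independent (R : realType) (m : nat) (P : {mpoly R[m + m]}) :
  subst_generators P = 0 -> P = 0.
Proof.
move=> P0; apply: mpoly_fun_eq0 => g.
(* The value 0 for [j >= m] is arbitrary; those generators do not occur in [P]. *)
pose g' b j := if insub j is Some j' then g (gen_ord b (j' : 'I_m)) else 0.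
have [w [w0 w1 w2 w3 wg]] := gen_value_onto g' (m.*2).+4.
have [u [v uvw]] := jet_realised (m.*2).+4 w.
have d0 : (delta u v).[w 0%N] != 0.
  have y0 := uvw 1%N isT; have y1 := uvw 3 isT; rewrite /= in y0 y1.
  rewrite /delta hornerD hornerN hornerM y0 y1 w0 w1 w3 hornerX.
  by rewrite mul1r subr0 oner_neq0.
have -> : P.@[g] = P.@[gen_vector u v (w 0%N)].
  apply: meval_eq => i; case: (split_ordP i) => j ->.
    rewrite (gen_vector_ord false) (wg u v) //=; last first.
    by rewrite /gen_index; have := ltn_ord j; lia.
    by rewrite /g' insubT // => jm; congr g; apply: val_inj.
  rewrite (gen_vector_ord true) (wg u v) //=; last first.
    by rewrite /gen_index; have := ltn_ord j; lia.
  by rewrite /g' insubT // => jm; congr g; apply: val_inj.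
have [F [G [rep FG]]] := subst_generators_value P.
have [G0 FE] := FG u v (w 0%N) d0.
have rep0 : represented (0 : jetrat R m.+1) (fun _ _ => 0) (fun _ _ => 1).
  by have := represented_const m.+1 (0 : R); rewrite mpolyC0 tofrac0 polyC0.
move: P0; rewrite (represented_eq rep rep0) => /(_ u v); rewrite mul0r mulr1 => F0.
by move/eqP: FE; rewrite F0 horner0 eq_sym mulf_eq0 (negbTE G0) => /eqP.
Qed.

(** * Cross-section and moving frame *)

(* The jets whose coordinates x, y, z, y_1 agree with those of a fixed jet form
   a cross-section of the orbits. *)
Lemma section_coord (R : realType) (u0 v0 : {poly R}) (t0 : R) (m i : nat) :
  (delta u0 v0).[t0] != 0 -> (area u0 v0).[t0] != 0 -> (i < (m.*2).+4)%N ->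
  exists sg : {mpoly R[m + m]}, forall u v t,
    (forall l, (l < 4)%N -> (jet_coord u v l).[t] = (jet_coord u0 v0 l).[t0]) ->
    (jet_coord u v i).[t] = sg.@[gen_vector u v t].
Proof.
move=> d0 a0; have [n] := ubnP i; elim: n i => // n IHn i; rewrite ltnS => lin im.
have [i4|i4] := ltnP i 4.
  by exists ((jet_coord u0 v0 i).[t0])%:MP => u v t uv; rewrite mevalC uv.
have [b [j iE]] : exists b j, i = gen_index b j.
  by exists (odd i), (i - 4)./2; rewrite /gen_index; lia.
have jm : (j < m)%N by move: im; rewrite iE /gen_index; lia.
have [C [S [E jC [Q SQ] jG nz]]] := gen_pair_triangular R b j.
have [sg sgE] : exists sg : 'I_(gen_index b j) -> {mpoly R[m + m]},
    forall (l : 'I_(gen_index b j)) u v t,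
    (forall l, (l < 4)%N -> (jet_coord u v l).[t] = (jet_coord u0 v0 l).[t0]) ->
    (jet_coord u v l).[t] = (sg l).@[gen_vector u v t].
  apply: (fin_all_exists (P := fun (l : 'I__) (sg : {mpoly R[m + m]}) => forall u v t,
    (forall l, (l < 4)%N -> (jet_coord u v l).[t] = (jet_coord u0 v0 l).[t0]) ->
    (jet_coord u v l).[t] = sg.@[gen_vector u v t])) => l; apply: (IHn l).
    by apply: leq_trans lin; rewrite iE.
  by apply: ltn_trans im; rewrite iE.
have [G0 /(_ a0) C0] := nz u0 v0 t0 d0.
(* The affine relation is solved for coordinate [i], with [C] and the denominator frozen at the base
   jet and the earlier coordinates replaced by [sg]. *)
exists ((C u0 v0).[t0]^-1 *: (((gen_pair R b j).2 u0 v0).[t0] *: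
  'X_(gen_ord b (Ordinal jm)) - mmap (@mpolyC _ R) sg Q)) => u v t uv.
rewrite mevalZ mevalB mevalZ mevalXU gen_vector_ord meval_mmap.
have -> : Q.@[fun l => (sg l).@[gen_vector u v t]] = (S u v).[t].
  by rewrite SQ horner_along; apply: meval_eq => l; rewrite sgE.
rewrite /gen_value E hornerD hornerM -iE (jet_fun_value jC uv) (jet_fun_value jG uv).
by rewrite /=; field; rewrite G0 C0.
Qed.

(** Prescribing x, y, z, y_1 of the image amounts to four equations for the four entries of [A]. *)
Lemma moving_frame (R : realType) (u0 v0 : {poly R}) (t0 : R) (u v : {poly R}) (t : R) :
  (delta u0 v0).[t0] != 0 -> (area u0 v0).[t0] != 0 ->
  (delta u v).[t] != 0 -> (area u v).[t] != 0 ->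
  exists A : 'M[R]_2, [/\ A \in unitmx, (imgX A u)^`().[t] != 0 &
    forall l, (l < 4)%N -> img_jet A u v t l = (jet_coord u0 v0 l).[t0]].
Proof.
move=> d0 a0 d1 a1.
(* This value is forced: [area] fixes det A, and [delta] fixes det A / X'. *)
pose X' := (area u0 v0).[t0] * (delta u v).[t] / ((area u v).[t] * (delta u0 v0).[t0]).
have X'0 : X' != 0 by rewrite !mulf_neq0 ?invr_eq0 ?mulf_neq0.
(* Each row of [A] solves a linear system of determinant [delta], which prescribes the value and the
   derivative at [t] of one component. *)
pose b := (t * X' - t0) / (delta u v).[t]; pose a := X' - b * u^`().[t].
pose d := (t * (u0^`().[t0] * X') - u0.[t0]) / (delta u v).[t].
pose c := u0^`().[t0] * X' - d * u^`().[t].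
pose A : 'M[R]_2 := \matrix_(i, j) if i == 0 then if j == 0 then a else b
  else if j == 0 then c else d.
have A00 : A 0 0 = a by rewrite mxE.
have A01 : A 0 1 = b by rewrite mxE.
have A10 : A 1 0 = c by rewrite mxE.
have A11 : A 1 1 = d by rewrite mxE.
have dE : (delta u v).[t] = t * u^`().[t] - u.[t].
  by rewrite /delta !hornerE.
have d0E : (delta u0 v0).[t0] = t0 * u0^`().[t0] - u0.[t0].
  by rewrite /delta !hornerE.
have X'E : (imgX A u)^`().[t] = X' by rewrite imgX_deriv A00 A01 /a subrK.
have detE : det2 A = (area u0 v0).[t0] / (area u v).[t].
  rewrite /det2 A00 A01 A10 A11.
  transitivity (X' * (delta u0 v0).[t0] / (delta u v).[t]).
    by rewrite /a /c /b /d d0E; field.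
  by rewrite /X'; field; rewrite d1 a1 d0.
have img0 : img_jet A u v t 0 = t0.
  rewrite /= /imgX A00 A01 hornerD !hornerZ hornerX /a.
  transitivity (t * X' - b * (delta u v).[t]); first by rewrite dE; ring.
  by rewrite /b divfK // opprB addrC subrK.
have img1 : img_jet A u v t 1 = u0.[t0].
  rewrite /= expr0 divr1 /imgY A10 A11 hornerD !hornerZ hornerX /c.
  transitivity (t * (u0^`().[t0] * X') - d * (delta u v).[t]); first by rewrite dE; ring.
  by rewrite /d divfK // opprB addrC subrK.
exists A; split; first by rewrite det2_neq0 detE mulf_neq0 ?invr_eq0.
  by rewrite X'E.
move=> [|[|[|[|//]]]] _.
- by rewrite img0 /= hornerX.
- by rewrite img1.
(* The coordinate z is recovered from [area], as x and y already agree. *)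
- have := img_jet_area A u v t; rewrite img0 img1 detE divfK // /area.
  rewrite hornerD hornerN hornerM hornerX => /addIr.
  by rewrite hornerMn => /eqP; rewrite eqrMn2r // => /eqP.
- rewrite img_jet3 ?X'E // /imgY A10 A11 derivD !derivZ derivX hornerD !hornerZ hornerC.
  by rewrite mulr1 /c subrK mulfK.
Qed.

(** * Invariants are exactly the rational functions of the generators *)

Lemma represented_div (R : realType) (k : nat) (f g : jetrat R k) F1 G1 F2 G2 :
  g != 0 -> represented f F1 G1 -> represented g F2 G2 ->
  represented (f / g) (fun u v => F1 u v * G2 u v) (fun u v => G1 u v * F2 u v).
Proof.
by move=> g0 fE gE; apply: represented_mul => //; apply: represented_inv.
Qed.

Lemma area_neq0 (R : realType) : exists u v : {poly R}, area u v != 0.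
Proof.
exists 0, 1; rewrite /area mulr0 subr0.
by apply/eqP => /(congr1 (horner^~ 0)) /eqP; rewrite hornerMn hornerC horner0 pnatr_eq0.
Qed.

Lemma jet_poly_delta (R : realType) : jet_poly (@delta R).
Proof. by exists 4; apply: jet_fun_delta. Qed.

Lemma jet_poly_area (R : realType) : jet_poly (@area R).
Proof. by exists 4; apply: jet_fun_area. Qed.

Lemma gen_vector_invariant (R : realType) (A : 'M[R]_2) (m : nat)
    (u v : {poly R}) (t : R) (U V : {poly R}) (s : R) :
  A \in unitmx -> (imgX A u)^`().[t] != 0 -> (delta u v).[t] != 0 ->
  (forall i, (i < m.*2.+4.+3)%N -> (jet_coord U V i).[s] = img_jet A u v t i) ->
  gen_vector U V s =1 @gen_vector R m u v t.
Proof.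
move=> uA X'0 d1 UV.
have inv b (j : 'I_m) : gen_value b j U V s = gen_value b j u v t.
  apply: (gen_value_invariant uA X'0 d1) => l lj; apply: UV.
  by apply: leq_trans lj _; have := ltn_ord j; rewrite /gen_index; lia.
by rewrite /gen_vector => i; case: (split i) => j.
Qed.

Lemma invariant_rational (R : realType) (k : nat) (f : jetrat R k) :
  diff_invariant f -> rational_in_generators f.
Proof.
move=> finv; set nf := \n_(repr f); set df := \d_(repr f).
have df0 : df != 0 by apply: denom_ratioP.
(* The base jet of the section avoids the zeros of the denominator, so that [Q] below does not
   vanish under substitution. *)
have [u0 [v0 [t0 [df_t0 d_t0 a_t0]]]] : exists u0 v0 t0,
    [/\ (along df u0 v0).[t0] != 0, (delta u0 v0).[t0] != 0 & (area u0 v0).[t0] != 0].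
  have da := jet_poly_mulf_neq0 (jet_poly_delta R) (jet_poly_area R)
    (delta_neq0 R) (area_neq0 R).
  have [u0 [v0 uv0]] := jet_poly_mulf_neq0 (jet_poly_along df)
    (jet_polyM (jet_poly_delta R) (jet_poly_area R)) (along_neq0 df0) da.
  have [t0] := poly_neq0_fun uv0; rewrite !hornerM !mulf_eq0 !negb_or.
  by case/andP=> ? /andP[? ?]; exists u0, v0, t0.
have [sg sgE] : exists sg : 'I_(ncoord k) -> {mpoly R[k + k]},
    forall (i : 'I_(ncoord k)) u v t,
    (forall l, (l < 4)%N -> (jet_coord u v l).[t] = (jet_coord u0 v0 l).[t0]) ->
    (jet_coord u v i).[t] = (sg i).@[gen_vector u v t].
  apply: (fin_all_exists (P := fun (i : 'I__) (sg : {mpoly R[k + k]}) => forall u v t,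
    (forall l, (l < 4)%N -> (jet_coord u v l).[t] = (jet_coord u0 v0 l).[t0]) ->
    (jet_coord u v i).[t] = sg.@[gen_vector u v t])) => i; apply: section_coord => //.
  by apply: leq_trans (ltn_ord i) _; rewrite /ncoord.
(* Numerator and denominator restricted to the section, written in the generators. *)
pose P := mmap (@mpolyC (k + k) R) sg nf; pose Q := mmap (@mpolyC (k + k) R) sg df.
have sgP (T : jetpoly R k) u v t :
    (forall l, (l < 4)%N -> (jet_coord u v l).[t] = (jet_coord u0 v0 l).[t0]) ->
    (mmap (@mpolyC (k + k) R) sg T).@[gen_vector u v t] = (along T u v).[t].
  by move=> uv; rewrite meval_mmap horner_along; apply: meval_eq => i; rewrite sgE.
have [FQ [GQ [repQ QE]]] := subst_generators_value Q.
have [FP [GP [repP PE]]] := subst_generators_value P.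
have FQ0 : (FQ u0 v0).[t0] != 0.
  by have [G0 ->] := QE u0 v0 t0 d_t0; rewrite mulf_neq0 // sgP.
have Q0 : subst_generators Q != 0.
  apply: contraNneq FQ0 => Q0.
  have rep0 : represented (0 : jetrat R k.+1) (fun _ _ => 0) (fun _ _ => 1).
    by have := represented_const k.+1 (0 : R); rewrite mpolyC0 tofrac0 polyC0.
  move: Q0; rewrite (represented_eq repQ rep0) => /(_ u0 v0).
  by rewrite mul0r mulr1 => ->; rewrite horner0.
exists k; first exact: leqnSn.
exists Q => //; exists P.
rewrite (represented_eq (represented_lift (leqnSn k) (represented_repr f))
  (represented_div Q0 repP repQ)) -/nf -/df => u v; apply/eqP; rewrite -subr_eq0.
have [jFP jGP _] := represented_jet_poly repP.
have [jFQ jGQ _] := represented_jet_poly repQ.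
pose H u v := along df u v * (delta u v * (area u v * FQ u v)).
apply/eqP; move: u v; apply: (@jet_poly_generic_eq0 _ _ H).
- apply: jet_polyD; first by do ?apply: jet_polyM => //; apply: jet_poly_along.
  by apply: jet_polyN; do ?apply: jet_polyM => //; apply: jet_poly_along.
- do ?apply: jet_polyM => //; first exact: jet_poly_along.
    exact: jet_poly_delta.
  exact: jet_poly_area.
- exists u0, v0; apply/eqP => /(congr1 (horner^~ t0)) /eqP.
  by rewrite horner0 !hornerM !mulf_eq0 (negbTE df_t0) (negbTE d_t0) (negbTE a_t0)
       (negbTE FQ0).
move=> u v t; rewrite !hornerM !mulf_eq0 !negb_or => /and4P[dft d1 a1 FQt].
(* A generic jet is moved to the section, where [P] and [Q] compute [f]; the generators have the
   same values at both jets. *)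
have [A [uA X'0 imgA]] := moving_frame d_t0 a_t0 d1 a1.
have [U [V [s UV]]] := img_realised A u v t (k.*2).+4.+3.
have UVk (T : jetpoly R k) : T.@[fun i => img_jet A u v t i] = (along T U V).[s].
  rewrite horner_along; apply: meval_eq => i; rewrite UV //.
  exact: leq_trans (ltn_ord i) (leq_addl 4 _).
have gUV := gen_vector_invariant uA X'0 d1 UV.
have base l : (l < 4)%N -> (jet_coord U V l).[s] = (jet_coord u0 v0 l).[t0].
  by move=> l4; rewrite -imgA // UV //; apply: leq_trans l4 _.
have [GP0 FPE] := PE u v t d1; have [GQ0 FQE] := QE u v t d1.
have := pullback_identity uA (finv A uA) v X'0.
rewrite -/nf -/df !UVk -!(sgP _ U V s base) -/P -/Q.
rewrite !(meval_eq _ gUV) => e.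
rewrite hornerD hornerN !hornerM FPE FQE; apply/eqP; rewrite subr_eq0; apply/eqP.
transitivity (((along nf u v).[t] * Q.@[gen_vector u v t]) * (GP u v).[t] * (GQ u v).[t]).
  ring.
rewrite -e; ring.
Qed.

(** Where [delta] and the denominator are nonzero, [f] is computed from generator values, which
    agree at a jet and at its image; [represented_pullback] extends this to all points. *)
Lemma rational_invariant (R : realType) (k : nat) (f : jetrat R k) :
  rational_in_generators f -> diff_invariant f.
Proof.
move=> [m km [Q Q0 [P fE]]] A uA.
have [FQ [GQ [repQ QE]]] := subst_generators_value Q.
have [FP [GP [repP PE]]] := subst_generators_value P.
have := represented_eq (represented_lift km (represented_repr f))
  (represented_div Q0 repP repQ).
case=> /(_ fE) {}fE _.
have [jFQ jGQ _] := represented_jet_poly repQ.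
have FQ0 : exists u v, FQ u v != 0.
  have [S [T [T0 QST SF TG]]] := repQ.
  have S0 : S != 0 by apply: contraNneq Q0 => S0; rewrite QST S0 tofrac0 mul0r.
  by have [u [v uv]] := along_neq0 S0; exists u, v; rewrite -SF.
apply: (represented_pullback (n := (m.*2).+4.+3) uA (represented_repr f) (represented_repr f)
  (jet_polyM (jet_poly_delta R) jFQ)
  (jet_poly_mulf_neq0 (jet_poly_delta R) jFQ (delta_neq0 R) FQ0)).
move=> u v t U V s X'0; rewrite hornerM mulf_eq0 negb_or => /andP[d1 FQt] UV.
have D1 : (delta U V).[s] != 0.
  have [|-> _ _ _] := @img_curve R A u v t U V s X'0.
    by move=> i i6; apply: UV; apply: leq_trans i6 _.
  by rewrite !mulf_neq0 ?invr_eq0 // -det2_neq0.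
have gUV := gen_vector_invariant uA X'0 d1 UV.
have E1 := congr1 (horner^~ t) (fE u v); have E2 := congr1 (horner^~ s) (fE U V).
rewrite !hornerM in E1 E2.
have [GP0 FPE] := PE u v t d1; have [GQ0 FQE] := QE u v t d1.
have [GP0' FPE'] := PE U V s D1; have [GQ0' FQE'] := QE U V s D1.
rewrite FQE mulf_eq0 negb_or in FQt; case/andP: FQt => _.
rewrite FPE FQE in E1; rewrite FPE' FQE' !(meval_eq _ gUV) in E2.
move: E1 E2; set p := meval _ P; set q := meval _ Q => E1 E2 q0.
have cancel (a b x y : R) : a != 0 -> b != 0 ->
    x * (a * (b * q)) = a * p * b * y -> x * q = p * y.
  move=> a0' b0 e; apply: (mulfI a0'); apply: (mulfI b0).
  transitivity (x * (a * (b * q))); first by ring.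
  by rewrite e; ring.
have {}E1 := cancel _ _ _ _ GP0 GQ0 E1; have {}E2 := cancel _ _ _ _ GP0' GQ0' E2.
apply: (mulIf q0); rewrite mulrAC E2 mulrAC -E1; ring.
Qed.

Theorem theorem8p1 (R : realType) :
  [/\ diff_invariant (I1 R),
      diff_invariant (I2a' R),
      invariant_derivation (nabla'_coef R),
      (forall (k : nat) (f : jetrat R k),
         diff_invariant f <-> rational_in_generators f) &
      (forall (m : nat) (P : {mpoly R[m + m]}),
         subst_generators P = 0 -> P = 0)].
Proof.
split.
- exact: I1_invariant.
- exact: I2a'_invariant.
- exact: nabla'_invariant.
- by move=> k f; split; [apply: invariant_rational|apply: rational_invariant].
- exact: generators_independent.
Qed.
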